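(* Generalized core spanners can be maintained in $\mathsf{DynFO}$: for every generalized core spanner $P$, the spanner relation $R^P$ can be maintained by a dynamic program with first-order update formulas.
   Context: Spanners: for $w=a_1\cdots a_n$ a span $[i,j\rangle$ ($1\le i\le j\le n+1$) denotes $a_i\cdots a_{j-1}$; a spanner $P$ with $\mathrm{SVars}(P)=V$ maps $w$ to a set of functions $\mu$ from $V$ to spans. Generalized core spanners are obtained from regex formulas (regular expressions with variable bindings $x\{\gamma\}$, each variable bound exactly once per match) by closure under union, projection, natural join, equality selection $\zeta^=_{x,y}$ (keep $\mu$ with $w_{\mu(x)}=w_{\mu(y)}$) and difference of spanners with the same variable set. Dynamic setting: word-structure with domain $D=\{1,\dots,n+1\}$, order $<$, constant $\$=n+1$, unary $P_a$ ($a\in\Sigma$), each position $\le n$ carrying at most one letter, $\$$ none; $\mathrm{pos}(x)$ of a letter-carrying position $x$ is the number of letter-carrying positions $\le x$. Updates $\mathrm{ins}_a(i)$ and $\mathrm{reset}(i)$ set/clear the letter at $i\ne\$$ (must change the word). A dynamic program: auxiliary relations over $D$ initialized by first-order formulas on the initially empty structure, updated by update formulas $\phi(u;\bar x)$ evaluated on the updated word structure and old auxiliary relations; it maintains a relation if a designated auxiliary relation always equals it. $\mathsf{DynFO}$: update formulas are first-order. Spanner relation $R^P$ for $\mathrm{SVars}(P)=\{x_1,\dots,x_k\}$: $2k$-ary relation of tuples $(\hat x_1,\check x_1,\dots,\hat x_k,\check x_k)$ with $\mu(x_i)=[\mathrm{pos}(\hat x_i),\mathrm{pos}(\check x_i)\rangle$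 for some $\mu\in P(\text{current word})$, except $\check x_i=\$$ when $\mu(x_i)=[j,|w|+1\rangle$. *)

(* Defs.v *)
From HB Require Import structures.
From mathcomp Require Import all_boot.
From mathcomp Require Import finmap.

Set Implicit Arguments.
Unset Strict Implicit.
Unset Printing Implicit Defensive.

Local Open Scope fset_scope.
Local Open Scope fmap_scope.

#[local] Obligation Tactic := idtac.

(* Span variables come from a fixed countably infinite supply. *)
Definition var := nat.

(* The span [i, j> is the pair (i, j); positions count from 1. *)
Definition span := (nat * nat)%type.

Definition is_span (T : Type) (w : seq T) (s : span) : bool :=
  [&& 1 <= s.1, s.1 <= s.2 & s.2 <= (size w).+1].

(* a_i ... a_(j-1) for the span [i, j> of w = a_1 ... a_n. *)
Definition factor (T : Type) (w : seq T) (s : span) : seq T :=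
  take (s.2 - s.1) (drop s.1.-1 w).

Definition mapping := {fmap var -> span}.

Record spanner (Sigma : finType) := Spanner {
  svars : {fset var};
  mappings :> seq Sigma -> mapping -> Prop;
  mappings_dom : forall w mu, mappings w mu -> domf mu = svars;
  mappings_span : forall w mu, mappings w mu ->
    forall x s, mu.[? x] = Some s -> is_span w s
}.

Inductive regex (Sigma : finType) : Type :=
| REmpty
| REps
| RLetter of Sigma
| RAlt of regex Sigma & regex Sigma
| RCat of regex Sigma & regex Sigma
| RStar of regex Sigma
| RBind of var & regex Sigma.

Arguments REmpty {Sigma}.
Arguments REps {Sigma}.

Fixpoint rvars (Sigma : finType) (g : regex Sigma) : {fset var} :=
  match g with
  | REmpty | REps | RLetter _ => fset0
  | RAlt g1 g2 | RCat g1 g2 => rvars g1 `|` rvars g2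
  | RStar g1 => rvars g1
  | RBind x g1 => x |` rvars g1
  end.

(* The semantics goes through ref-words: words over the letters and, for each
   variable x, an opening and a closing bracket marking where x is bound. *)
Inductive refsym (Sigma : finType) : Type :=
| Letter of Sigma
| Open of var
| Close of var.

Arguments Open {Sigma}.
Arguments Close {Sigma}.

Definition refsym_code (Sigma : finType) (c : refsym Sigma) :
    Sigma + (var + var) :=
  match c with
  | Letter a => inl a
  | Open x => inr (inl x)
  | Close x => inr (inr x)
  end.

Definition refsym_decode (Sigma : finType) (c : Sigma + (var + var)) :
    refsym Sigma :=
  match c with
  | inl a => Letter a
  | inr (inl x) => Open x
  | inr (inr x) => Close x
  end.

Lemma refsym_codeK (Sigma : finType) :
  cancel (@refsym_code Sigma) (@refsym_decode Sigma).
Proof. by case. Qed.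

HB.instance Definition _ (Sigma : finType) :=
  Equality.copy (refsym Sigma) (can_type (@refsym_codeK Sigma)).

Inductive ref_lang (Sigma : finType) : regex Sigma -> seq (refsym Sigma) -> Prop :=
| RL_eps : ref_lang REps [::]
| RL_letter a : ref_lang (RLetter a) [:: Letter a]
| RL_altl g1 g2 r : ref_lang g1 r -> ref_lang (RAlt g1 g2) r
| RL_altr g1 g2 r : ref_lang g2 r -> ref_lang (RAlt g1 g2) r
| RL_cat g1 g2 r1 r2 :
    ref_lang g1 r1 -> ref_lang g2 r2 -> ref_lang (RCat g1 g2) (r1 ++ r2)
| RL_star0 g : ref_lang (RStar g) [::]
| RL_starS g r1 r2 :
    ref_lang g r1 -> ref_lang (RStar g) r2 -> ref_lang (RStar g) (r1 ++ r2)
| RL_bind x g r :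
    ref_lang g r -> ref_lang (RBind x g) (Open x :: rcons r (Close x)).

(* The word obtained from a ref-word by erasing the brackets. *)
Definition clr (Sigma : finType) (r : seq (refsym Sigma)) : seq Sigma :=
  pmap (fun c => if c is Letter a then Some a else None) r.

Definition valid_ref (Sigma : finType) (V : {fset var})
    (r : seq (refsym Sigma)) : Prop :=
  forall x, x \in V ->
    [/\ count_mem (Open x) r = 1, count_mem (Close x) r = 1
      & index (Open x) r < index (Close x) r].

Definition functional (Sigma : finType) (g : regex Sigma) : Prop :=
  forall r, ref_lang g r -> valid_ref (rvars g) r.

(* The span of x in a ref-word r1 (Open x) r2 (Close x) r3 is
   [|clr r1| + 1, |clr (r1 r2)| + 1>. *)
Definition ref_span (Sigma : finType) (r : seq (refsym Sigma)) (x : var) : span :=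
  ((size (clr (take (index (Open x) r) r))).+1,
   (size (clr (take (index (Close x) r) r))).+1).

Definition ref_mapping (Sigma : finType) (V : {fset var})
    (r : seq (refsym Sigma)) : mapping :=
  [fmap x : V => ref_span r (val x)].

Definition regex_mappings (Sigma : finType) (g : regex Sigma)
    (w : seq Sigma) (mu : mapping) : Prop :=
  exists r, [/\ ref_lang g r, valid_ref (rvars g) r, clr r = w
              & mu = ref_mapping (rvars g) r].

Lemma clr_take_le (Sigma : finType) (r : seq (refsym Sigma)) m n :
  m <= n -> size (clr (take m r)) <= size (clr (take n r)).
Proof.
move=> le_mn; rewrite -(cat_take_drop m (take n r)) take_takel //.
by rewrite /clr pmap_cat size_cat leq_addr.
Qed.

Lemma regex_mappings_dom (Sigma : finType) (g : regex Sigma) w mu :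
  regex_mappings g w mu -> domf mu = rvars g.
Proof. by case=> r [_ _ _ ->]. Qed.

Lemma regex_mappings_span (Sigma : finType) (g : regex Sigma) w mu :
  regex_mappings g w mu ->
  forall x s, mu.[? x] = Some s -> is_span w s.
Proof.
case=> r [_ vr <- ->] x s; case: fndP => // xV [<-].
rewrite ffunE /= /is_span /= !ltnS.
have [_ _ lt_ix] := vr x xV.
rewrite clr_take_le ?(ltnW lt_ix) //=.
by rewrite -[X in _ <= size (clr X)]take_size clr_take_le // index_size.
Qed.

Definition regex_spanner (Sigma : finType) (g : regex Sigma) : spanner Sigma :=
  Spanner (@regex_mappings_dom Sigma g) (@regex_mappings_span Sigma g).

Program Definition union_spanner (Sigma : finType) (P1 P2 : spanner Sigma)
    (E : svars P1 = svars P2) : spanner Sigma :=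
  @Spanner Sigma (svars P1) (fun w mu => P1 w mu \/ P2 w mu) _ _.
Next Obligation.
Proof.
by move=> Sigma P1 P2 E w mu [/mappings_dom|/mappings_dom ->].
Qed.
Next Obligation.
Proof.
by move=> Sigma P1 P2 E w mu [] /mappings_span.
Qed.

Program Definition proj_spanner (Sigma : finType) (Y : {fset var})
    (P : spanner Sigma) : spanner Sigma :=
  @Spanner Sigma (Y `&` svars P)
    (fun w mu => exists2 nu, P w nu & mu = nu.[& Y]) _ _.
Next Obligation.
Proof.
by move=> Sigma Y P w mu [nu /mappings_dom Pnu ->]; rewrite domf_restrict Pnu.
Qed.
Next Obligation.
Proof.
move=> Sigma Y P w mu [nu /mappings_span Pnu ->] x s.
by rewrite fnd_restrict; case: ifP => // _ /Pnu.
Qed.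

Program Definition join_spanner (Sigma : finType) (P1 P2 : spanner Sigma) :
    spanner Sigma :=
  @Spanner Sigma (svars P1 `|` svars P2)
    (fun w mu => [/\ domf mu = svars P1 `|` svars P2,
                     P1 w mu.[& svars P1] & P2 w mu.[& svars P2]]) _ _.
Next Obligation. by move=> Sigma P1 P2 w mu []. Qed.
Next Obligation.
Proof.
move=> Sigma P1 P2 w mu [dmu /mappings_span m1 /mappings_span m2] x s mux.
have: x \in svars P1 `|` svars P2 by rewrite -dmu -fndSome mux.
rewrite inE => /orP[xV|xV]; [apply: (m1 x)|apply: (m2 x)].
all: by rewrite fnd_restrict xV.
Qed.

Program Definition eqsel_spanner (Sigma : finType) (x y : var)
    (P : spanner Sigma) : spanner Sigma :=
  @Spanner Sigma (svars P)
    (fun w mu => P w mu /\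
       exists s t, [/\ mu.[? x] = Some s, mu.[? y] = Some t
                     & factor w s = factor w t]) _ _.
Next Obligation. by move=> Sigma x y P w mu [/mappings_dom]. Qed.
Next Obligation. by move=> Sigma x y P w mu [/mappings_span]. Qed.

Program Definition diff_spanner (Sigma : finType) (P1 P2 : spanner Sigma) :
    spanner Sigma :=
  @Spanner Sigma (svars P1) (fun w mu => P1 w mu /\ ~ P2 w mu) _ _.
Next Obligation. by move=> Sigma P1 P2 w mu [/mappings_dom]. Qed.
Next Obligation. by move=> Sigma P1 P2 w mu [/mappings_span]. Qed.

Inductive generalized_core (Sigma : finType) : spanner Sigma -> Prop :=
| GC_regex g : functional g -> generalized_core (regex_spanner g)
| GC_union P1 P2 (E : svars P1 = svars P2) :
    generalized_core P1 -> generalized_core P2 ->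
    generalized_core (union_spanner E)
| GC_proj Y P : Y `<=` svars P ->
    generalized_core P -> generalized_core (proj_spanner Y P)
| GC_join P1 P2 :
    generalized_core P1 -> generalized_core P2 ->
    generalized_core (join_spanner P1 P2)
| GC_eqsel x y P : x \in svars P -> y \in svars P ->
    generalized_core P -> generalized_core (eqsel_spanner x y P)
| GC_diff P1 P2 : svars P1 = svars P2 ->
    generalized_core P1 -> generalized_core P2 ->
    generalized_core (diff_spanner P1 P2).

(* The domain {1, ..., n+1} is 'I_n.+1, shifted to start at 0, and the constant
   $ is ord_max. A word-structure records the letter carried by each position,
   if any. That $ carries none is not part of the type: it holds initially and
   is preserved by the admissible updates, which never touch $. *)
Definition wstruct (Sigma : finType) (n : nat) :=
  {ffun 'I_n.+1 -> option Sigma}.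

Definition empty_wstruct (Sigma : finType) (n : nat) : wstruct Sigma n :=
  [ffun=> None].

Definition word_of (Sigma : finType) (n : nat) (w : wstruct Sigma n) :
    seq Sigma :=
  pmap w (enum 'I_n.+1).

(* Meaningful when i carries a letter. *)
Definition pos (Sigma : finType) (n : nat) (w : wstruct Sigma n)
    (i : 'I_n.+1) : nat :=
  #|[set j : 'I_n.+1 | (j <= i) && isSome (w j)]|.

Inductive update_op (Sigma : finType) : Type :=
| Ins of Sigma
| Reset.

Arguments Reset {Sigma}.

Definition op_letter (Sigma : finType) (o : update_op Sigma) : option Sigma :=
  if o is Ins a then Some a else None.

Definition update (Sigma : finType) (n : nat) (w : wstruct Sigma n)
    (o : update_op Sigma) (i : 'I_n.+1) : wstruct Sigma n :=
  [ffun j => if j == i then op_letter o else w j].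

Definition admissible (Sigma : finType) (n : nat) (w : wstruct Sigma n)
    (o : update_op Sigma) (i : 'I_n.+1) : bool :=
  (i != ord_max) && (update w o i != w).

Record signature := Signature { sym : finType; arity : sym -> nat }.

Definition no_aux : signature := @Signature void (fun=> 0).

Inductive term (k : nat) : Type :=
| TVar of 'I_k
| TEnd.

Arguments TEnd {k}.

(* Formulas with free variables among 'I_k; a quantifier binds variable 0 of
   its body and shifts the other variables up by one. *)
Inductive formula (Sigma : finType) (tau : signature) : nat -> Type :=
| FFalse k : formula Sigma tau k
| FEq k : term k -> term k -> formula Sigma tau k
| FLt k : term k -> term k -> formula Sigma tau k
| FLetter k : Sigma -> term k -> formula Sigma tau k
| FRel k (R : sym tau) : (arity R).-tuple (term k) -> formula Sigma tau k
| FNot k : formula Sigma tau k -> formula Sigma tau k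
| FAnd k : formula Sigma tau k -> formula Sigma tau k -> formula Sigma tau k
| FOr k : formula Sigma tau k -> formula Sigma tau k -> formula Sigma tau k
| FEx k : formula Sigma tau k.+1 -> formula Sigma tau k
| FAll k : formula Sigma tau k.+1 -> formula Sigma tau k.

Definition aux_structure (tau : signature) (n : nat) :=
  forall R : sym tau, pred ((arity R).-tuple 'I_n.+1).

Definition no_aux_structure (n : nat) : aux_structure no_aux n :=
  fun R => match R with end.

Definition eval_term (n k : nat) (e : k.-tuple 'I_n.+1) (t : term k) : 'I_n.+1 :=
  if t is TVar i then tnth e i else ord_max.

Fixpoint eval (Sigma : finType) (tau : signature) (n k : nat)
    (w : wstruct Sigma n) (A : aux_structure tau n)
    (phi : formula Sigma tau k) : k.-tuple 'I_n.+1 -> bool :=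
  match phi in formula _ _ k return k.-tuple 'I_n.+1 -> bool with
  | FFalse _ => fun=> false
  | FEq _ t1 t2 => fun e => eval_term e t1 == eval_term e t2
  | FLt _ t1 t2 => fun e => eval_term e t1 < eval_term e t2
  | FLetter _ a t => fun e => w (eval_term e t) == Some a
  | FRel _ R ts => fun e => A R (map_tuple (eval_term e) ts)
  | FNot _ p => fun e => ~~ eval w A p e
  | FAnd _ p q => fun e => eval w A p e && eval w A q e
  | FOr _ p q => fun e => eval w A p e || eval w A q e
  | FEx _ p => fun e => [exists d, eval w A p (cons_tuple d e)]
  | FAll _ p => fun e => [forall d, eval w A p (cons_tuple d e)]
  end.

(* In the update formula phi(u; x_1, ..., x_k), u is variable 0. A program does
   not depend on the size of the domain. *)
Record dyn_program (Sigma : finType) := DynProgram {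
  aux_sig : signature;
  init_formula : forall R : sym aux_sig, formula Sigma no_aux (arity R);
  update_formula : forall (o : update_op Sigma) (R : sym aux_sig),
    formula Sigma aux_sig (arity R).+1
}.

Record state (Sigma : finType) (p : dyn_program Sigma) (n : nat) := State {
  st_word : wstruct Sigma n;
  st_aux : aux_structure (aux_sig p) n
}.

Definition init_state (Sigma : finType) (p : dyn_program Sigma) (n : nat) :
    state p n :=
  State (empty_wstruct Sigma n)
    (fun R => eval (empty_wstruct Sigma n) (@no_aux_structure n)
                   (init_formula R)).

Definition step (Sigma : finType) (p : dyn_program Sigma) (n : nat)
    (s : state p n) (o : update_op Sigma) (i : 'I_n.+1) : state p n :=
  let w' := update (st_word s) o i in
  State w'
    (fun R x => eval w' (st_aux s) (update_formula o R) (cons_tuple i x)).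

Inductive reachable (Sigma : finType) (p : dyn_program Sigma) (n : nat) :
    state p n -> Prop :=
| Reach_init : reachable (init_state p n)
| Reach_step s o i : reachable s -> admissible (st_word s) o i ->
    reachable (step s o i).

Definition word_relation (Sigma : finType) (m : nat) :=
  forall n, wstruct Sigma n -> m.-tuple 'I_n.+1 -> Prop.

Definition maintains (Sigma : finType) (p : dyn_program Sigma) (m : nat)
    (Q : word_relation Sigma m) : Prop :=
  exists (R : sym (aux_sig p)) (E : m = arity R),
    forall n (s : state p n), reachable s ->
    forall x : m.-tuple 'I_n.+1, st_aux s (tcast E x) <-> Q n (st_word s) x.

Definition in_DynFO (Sigma : finType) (m : nat) (Q : word_relation Sigma m) :
    Prop :=
  exists p : dyn_program Sigma, maintains p Q.

(* The element i of the domain stands for the position m of the current word: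
   the position |w| + 1, which carries no letter, is represented by $. *)
Definition represents (Sigma : finType) (n : nat) (w : wstruct Sigma n)
    (i : 'I_n.+1) (m : nat) : bool :=
  if i == ord_max then m == (size (word_of w)).+1
  else isSome (w i) && (pos w i == m).

(* For an enumeration xs of svars P, the components 2i and 2i+1 of a tuple
   represent the two ends of the span of the i-th variable. *)
Definition spanner_relation (Sigma : finType) (P : spanner Sigma) (k : nat)
    (xs : k.-tuple var) : word_relation Sigma (2 * k) :=
  fun n w t =>
    exists2 mu : mapping, P (word_of w) mu &
      forall i : 'I_k, exists s : span,
        [/\ mu.[? tnth xs i] = Some s,
            represents w (nth ord_max t (2 * i)) s.1
          & represents w (nth ord_max t (2 * i).+1) s.2].

(* Main.v *)
Require Import Defs.
From mathcomp Require Import all_boot.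
From mathcomp Require Import finmap.
From mathcomp Require Import zify.
From Stdlib Require Import Classical.

Set Implicit Arguments.
Unset Strict Implicit.
Unset Printing Implicit Defensive.

(* A regular expression is turned into a finite automaton over letters and
    variable brackets. The dynamic program stores, for words in half-open
    intervals of the domain, two relations: a run over [x, y) leads from state
    q to state q', and the factors at [x, y) and [x', y') are equal.

    Both survive a change at u. A run is recomposed from the parts before and
    after u, which still carry their old information. For equality, cut [x, y) at
    u and u + 1 and [x', y') at the corresponding places, then cut [x', y') at u
    and u + 1: every resulting pair consists of intervals that either avoid u or
    are {u}, and for these equality is known from the old relation or from a
    first-order property of the new word.

    Over these relations every generalized core spanner is first-order definable:
    union, projection, join and difference are connectives and quantifiers, equality
    selection is the equality relation. For a regex formula, the brackets are put
    back one at a time: a run of the automaton over [x, y) with a bracket at z in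
    [x, y) is a run up to z, a step at z and a run from z + 1.

    Since definability holds in every structure in which the two relations of the
    current word are definable, it holds both in the empty structure and in the
    updated structure with the old auxiliary relations. This gives the initial
    formula and the update formulas of the spanner relation, without substituting
    formulas into formulas. *)

(** * Automata for ref-words *)

(** The alphabet is an arbitrary type, since brackets of ref-words come from infinitely many
    variables. Transitions and final states are arbitrary propositions: they enter formulas only as
    truth constants. *)
Record automaton (A : Type) := Automaton {
  astate : finType;
  trans : astate -> A -> astate -> Prop;
  final : astate -> Prop
}.

Arguments trans {A a}.
Arguments final {A a}.

Fixpoint accepts (A : Type) (N : automaton A) (q : astate N) (r : seq A) : Prop :=
  if r is c :: r' then exists2 q', trans q c q' & accepts q' r' else final q.

Fixpoint run (A : Type) (N : automaton A) (q : astate N) (r : seq A)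
    (q' : astate N) : Prop :=
  if r is c :: r' then exists2 q1, trans q c q1 & run q1 r' q' else q = q'.

Lemma run_cat (A : Type) (N : automaton A) (q q' : astate N) r1 r2 :
  run q (r1 ++ r2) q' <-> exists2 q1, run q r1 q1 & run q1 r2 q'.
Proof.
elim: r1 q => [|c r1 IH] q /=; first by split=> [?|[_ <-] //]; exists q.
split=> [[q1 t /IH[q2 ? ?]]|[q2 [q1 t ?] ?]]; first by exists q2 => //; exists q1.
by exists q1 => //; apply/IH; exists q2.
Qed.

Lemma acceptsE (A : Type) (N : automaton A) (q : astate N) r :
  accepts q r <-> exists2 q', run q r q' & final q'.
Proof.
elim: r q => [|c r IH] q /=; first by split=> [?|[_ <-] //]; exists q.
split=> [[q1 t /IH[q2 ? ?]]|[q2 [q1 t ?] ?]]; first by exists q2 => //; exists q1.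
by exists q1 => //; apply/IH; exists q2.
Qed.

Definition recognizable (A : Type) (L : seq A -> Prop) : Prop :=
  exists (N : automaton A) (q : astate N), forall r, L r <-> accepts q r.

(* A finite family of languages closed under nondeterministic left quotients by
   letters is the state space of an automaton. *)
Lemma recognizable_family (A : Type) (Q : finType)
    (tr : Q -> A -> Q -> Prop) (L : Q -> seq A -> Prop) (q : Q) :
  (forall q c r, L q (c :: r) <-> exists2 q', tr q c q' & L q' r) ->
  recognizable (L q).
Proof.
move=> Ltr; exists (@Automaton A Q tr (L^~ [::])), q => r.
elim: r q => //= c r IH q; rewrite Ltr.
by split=> -[q' ? /IH ?]; exists q'.
Qed.

Lemma recognizable_ext (A : Type) (L1 L2 : seq A -> Prop) :
  (forall r, L1 r <-> L2 r) -> recognizable L1 -> recognizable L2.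
Proof. by move=> E [N [q H]]; exists N, q => r; rewrite -E. Qed.

Lemma recognizable_empty (A : Type) : recognizable (fun _ : seq A => False).
Proof.
apply: (@recognizable_family A unit (fun _ _ _ => False) (fun _ _ => False) tt).
by move=> _ c r; split=> // -[].
Qed.

Lemma recognizable_eps (A : Type) : recognizable (fun r : seq A => r = [::]).
Proof.
apply: (@recognizable_family A unit (fun _ _ _ => False) (fun _ r => r = [::]) tt).
by move=> _ c r; split=> // -[].
Qed.

Lemma recognizable_letter (A : Type) (a : A) :
  recognizable (fun r : seq A => r = [:: a]).
Proof.
apply: (@recognizable_family A bool (fun b c b' => [/\ b, c = a & ~~ b'])
          (fun b r => r = if b then [:: a] else [::]) true).
move=> [] c r; split=> //.
- by case=> -> ->; exists false.
- by case=> -[] [] // _ -> _ ->.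
- by case=> q [].
Qed.

Lemma recognizable_alt (A : Type) (L1 L2 : seq A -> Prop) :
  recognizable L1 -> recognizable L2 -> recognizable (fun r => L1 r \/ L2 r).
Proof.
move=> [N1 [q1 H1]] [N2 [q2 H2]].
(* [None] is a fresh initial state whose first step is a first step of either automaton. *)
pose tr (q : option (astate N1 + astate N2)) c q' :=
  match q, q' with
  | Some (inl q), Some (inl q') => trans q c q'
  | Some (inr q), Some (inr q') => trans q c q'
  | None, Some (inl q') => trans q1 c q'
  | None, Some (inr q') => trans q2 c q'
  | _, _ => False
  end.
pose L (q : option (astate N1 + astate N2)) r :=
  match q with
  | Some (inl q) => accepts q r
  | Some (inr q) => accepts q r
  | None => accepts q1 r \/ accepts q2 r
  end.
apply: (@recognizable_ext _ (L None)); first by move=> r; rewrite H1 H2.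
apply: (recognizable_family (tr := tr)) => -[[q|q]|] c r /=; split.
- by case=> q' ? ?; exists (Some (inl q')).
- by case=> -[[q'|q']|] //; exists q'.
- by case=> q' ? ?; exists (Some (inr q')).
- by case=> -[[q'|q']|] //; exists q'.
- by case=> -[q' ? ?]; [exists (Some (inl q'))|exists (Some (inr q'))].
- by case=> -[[q'|q']|] //; [left|right]; exists q'.
Qed.

Lemma recognizable_cat (A : Type) (L1 L2 : seq A -> Prop) :
  recognizable L1 -> recognizable L2 ->
  recognizable (fun r => exists r1 r2, [/\ r = r1 ++ r2, L1 r1 & L2 r2]).
Proof.
move=> [N1 [q1 H1]] [N2 [q2 H2]].
(* There are no empty transitions, so leaving the first automaton is merged with reading the first
   letter of the second word. *)
pose tr (q : astate N1 + astate N2) c q' :=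
  match q, q' with
  | inl q, inl q' => trans q c q'
  | inr q, inr q' => trans q c q'
  | inl q, inr q' => final q /\ trans q2 c q'
  | _, _ => False
  end.
pose L (q : astate N1 + astate N2) r :=
  match q with
  | inl q => exists r1 r2, [/\ r = r1 ++ r2, accepts q r1 & accepts q2 r2]
  | inr q => accepts q r
  end.
apply: (@recognizable_ext _ (L (inl q1))).
  by move=> r; split=> -[r1 [r2 [-> /H1 ? /H2 ?]]]; exists r1, r2.
apply: (recognizable_family (tr := tr)) => -[q|q] c r /=; split.
- case=> -[|c1 r1] [r2 []] /=.
    by move=> <- ? [q' ? ?]; exists (inr q').
  by case=> -> -> [q' ? ?] ?; exists (inl q') => //; exists r1, r2.
- case=> -[q'|q'].
    by move=> ? [r1 [r2 [-> ? ?]]]; exists (c :: r1), r2; split=> //; exists q'.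
  by move=> [? ?] ?; exists [::], (c :: r); split=> //; exists q'.
- by case=> q' ? ?; exists (inr q').
- by case=> -[q'|q'] //; exists q'.
Qed.

(** The first nonempty iteration supplies [c]; empty iterations before it are skipped by induction
    on the derivation. *)
Lemma ref_lang_star_cons (Sigma : finType) (g : regex Sigma) c r :
  ref_lang (RStar g) (c :: r) <->
  exists r1 r2, [/\ r = r1 ++ r2, ref_lang g (c :: r1) & ref_lang (RStar g) r2].
Proof.
split=> [H|[r1 [r2 [-> H1 H2]]]]; last by rewrite -cat_cons; apply: RL_starS.
move Eh: (RStar g) H => h H; move Es: (c :: r) H => s H.
elim: H Eh c r Es => // {h s}h r1 r2 H1 _ H2 IH [Eh] c r; subst h.
case: r1 H1 => [_|c1 r1 H1] /=; first exact: IH.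
by case=> -> ->; exists r1, r2.
Qed.

Lemma recognizable_star (Sigma : finType) (g : regex Sigma) :
  recognizable (ref_lang g) -> recognizable (ref_lang (RStar g)).
Proof.
move=> [N [q0 H]].
pose tr (q : option (astate N)) c q' :=
  match q, q' with
  | Some q, Some q' => trans q c q' \/ final q /\ trans q0 c q'
  | None, Some q' => trans q0 c q'
  | _, _ => False
  end.
pose L (q : option (astate N)) r :=
  if q is Some q then
    exists r1 r2, [/\ r = r1 ++ r2, accepts q r1 & ref_lang (RStar g) r2]
  else ref_lang (RStar g) r.
apply: (@recognizable_family _ _ tr L None) => -[q|] c r /=; split.
- case=> -[|c1 r1] [r2 []] /=.
    move=> <- ? /ref_lang_star_cons[r3 [r4 [-> /H[q' ? ?] ?]]].
    by exists (Some q'); [right|exists r3, r4].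
  by case=> -> -> [q' ? ?] ?; exists (Some q'); [left|exists r1, r2].
- case=> -[q'|] // [t|[f t]] [r1 [r2 [-> ? ?]]].
    by exists (c :: r1), r2; split=> //; exists q'.
  exists [::], (c :: r1 ++ r2); split=> //.
  by apply/ref_lang_star_cons; exists r1, r2; split=> //; apply/H; exists q'.
- move=> /ref_lang_star_cons[r1 [r2 [-> /H[q' ? ?] ?]]].
  by exists (Some q') => //; exists r1, r2.
- case=> -[q'|] // ? [r1 [r2 [-> ? ?]]].
  by apply/ref_lang_star_cons; exists r1, r2; split=> //; apply/H; exists q'.
Qed.

Lemma recognizable_regex (Sigma : finType) (g : regex Sigma) :
  recognizable (ref_lang g).
Proof.
elim: g => [||a|g1 IH1 g2 IH2|g1 IH1 g2 IH2|g IH|x g IH].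
- by apply: recognizable_ext (recognizable_empty _) => r; split=> // H; inversion H.
- apply: recognizable_ext (recognizable_eps _) => r; split=> [->|H]; first exact: RL_eps.
  by inversion H.
- apply: recognizable_ext (recognizable_letter (Letter a)) => r.
  by split=> [->|H]; [exact: RL_letter|inversion H].
- apply: recognizable_ext (recognizable_alt IH1 IH2) => r.
  split=> [[]|H]; [exact: RL_altl|exact: RL_altr|].
  by inversion H; subst; [left|right].
- apply: recognizable_ext (recognizable_cat IH1 IH2) => r.
  split=> [[r1 [r2 [-> ? ?]]]|H]; first exact: RL_cat.
  by inversion H as [| | | |g3 g4 r1 r2| | |]; subst; exists r1, r2.
- exact: recognizable_star.
- apply: recognizable_ext (recognizable_cat (recognizable_letter (Open x))
    (recognizable_cat IH (recognizable_letter (Close x)))) => r.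
  split=> [[_ [_ [-> -> [r2 [_ [-> ? ->]]]]]]|H].
    by rewrite cats1; apply: RL_bind.
  inversion H as [| | | | | | |y h r2 H2]; subst.
  by exists [:: Open x], (rcons r2 (Close x)); split=> //; exists r2, [:: Close x];
    rewrite cats1.
Qed.

(** The program stores the runs of a single automaton, while a spanner may contain many regex
    formulas. It is enough that every state language of [N0] is also one of [N]. *)
Definition simulates (A : Type) (N N0 : automaton A) : Prop :=
  forall q0 : astate N0, exists q : astate N, forall r, accepts q0 r <-> accepts q r.

Lemma simulates_sum (A : Type) (N1 N2 : automaton A) :
  exists N0 : automaton A, forall N, simulates N N0 ->
    simulates N N1 /\ simulates N N2.
Proof.
pose tr (q : astate N1 + astate N2) c q' :=
  match q, q' with
  | inl q, inl q' => trans q c q'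
  | inr q, inr q' => trans q c q'
  | _, _ => False
  end.
pose f (q : astate N1 + astate N2) :=
  match q with inl q => final q | inr q => final q end.
exists (@Automaton A (astate N1 + astate N2)%type tr f) => N S; split=> q0.
- have [q Hq] := S (inl q0); exists q => r; rewrite -Hq {Hq}.
  elim: r q0 => //= c r IH q0.
  split=> [[q' ? /IH ?]|[[q'|q'] // ? /IH ?]]; last by exists q'.
  by exists (inl q').
- have [q Hq] := S (inr q0); exists q => r; rewrite -Hq {Hq}.
  elim: r q0 => //= c r IH q0.
  split=> [[q' ? /IH ?]|[[q'|q'] // ? /IH ?]]; last by exists q'.
  by exists (inr q').
Qed.

(** * Words in intervals and their updates *)

(** Indexing by natural numbers, with no letter outside the domain, allows intervals that end at
    [n.+1]. *)
Definition letter (Sigma : finType) (n : nat) (w : wstruct Sigma n) (i : nat) :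
    seq Sigma :=
  seq_of_opt (obind w (insub i)).

Definition wseg (Sigma : finType) (n : nat) (w : wstruct Sigma n) (x y : nat) :
    seq Sigma :=
  flatten [seq letter w i | i <- iota x (y - x)].

Lemma letter_ord (Sigma : finType) (n : nat) (w : wstruct Sigma n) (i : 'I_n.+1) :
  letter w i = seq_of_opt (w i).
Proof. by rewrite /letter valK. Qed.

Lemma size_letter (Sigma : finType) (n : nat) (w : wstruct Sigma n) i :
  size (letter w i) <= 1.
Proof. by rewrite /letter; case: obind. Qed.

Lemma letter_update (Sigma : finType) (n : nat) (w : wstruct Sigma n) o u i :
  letter (update w o u) i =
  if i == u then seq_of_opt (op_letter o) else letter w i.
Proof.
rewrite /letter; case: insubP => [j _ <-|]; first by rewrite /= ffunE val_eqE; case: ifP.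
by case: eqP => // -> /negP[].
Qed.

Lemma wseg_nil (Sigma : finType) (n : nat) (w : wstruct Sigma n) x y :
  y <= x -> wseg w x y = [::].
Proof. by rewrite /wseg -subn_eq0 => /eqP ->. Qed.

Lemma wseg_cat (Sigma : finType) (n : nat) (w : wstruct Sigma n) x y z :
  x <= y -> y <= z -> wseg w x z = wseg w x y ++ wseg w y z.
Proof.
move=> xy yz; rewrite /wseg -flatten_cat -map_cat.
have -> : z - x = (y - x) + (z - y) by lia.
by rewrite iotaD subnKC.
Qed.

Lemma wsegS (Sigma : finType) (n : nat) (w : wstruct Sigma n) x :
  wseg w x x.+1 = letter w x.
Proof. by rewrite /wseg subSnn /= cats0. Qed.

Lemma wseg_recl (Sigma : finType) (n : nat) (w : wstruct Sigma n) x y :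
  x < y -> wseg w x y = letter w x ++ wseg w x.+1 y.
Proof. by move=> xy; rewrite (@wseg_cat _ _ _ _ x.+1) ?wsegS. Qed.

Lemma word_ofE (Sigma : finType) (n : nat) (w : wstruct Sigma n) :
  word_of w = wseg w 0 n.+1.
Proof.
rewrite /word_of /wseg subn0 -val_enum_ord -map_comp.
elim: (enum _) => //= i s ->; rewrite letter_ord.
by case: (w i).
Qed.

Lemma word_of_end (Sigma : finType) (n : nat) (w : wstruct Sigma n) :
  w ord_max = None -> word_of w = wseg w 0 n.
Proof.
move=> we; rewrite word_ofE (@wseg_cat _ _ _ _ n) // wsegS.
by rewrite (letter_ord w ord_max) we cats0.
Qed.

Lemma wseg_update (Sigma : finType) (n : nat) (w : wstruct Sigma n) o
    (u : 'I_n.+1) x y :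
  u < x \/ y <= u -> wseg (update w o u) x y = wseg w x y.
Proof.
move=> H; congr flatten; apply/eq_in_map => i; rewrite mem_iota => Hi.
by rewrite letter_update; case: eqP => // E; lia.
Qed.

Lemma wseg_empty (Sigma : finType) (n : nat) x y :
  wseg (empty_wstruct Sigma n) x y = [::].
Proof.
rewrite /wseg; elim: (iota _ _) => //= i s ->; rewrite cats0 /letter.
by case: insub => //= j; rewrite ffunE.
Qed.

(** Each element contributes at most one letter, so every prefix of the word is reached at some cut;
    induction on the length of the interval. *)
Lemma wseg_cut (Sigma : finType) (n : nat) (w : wstruct Sigma n) x y s1 s2 :
  x <= y -> wseg w x y = s1 ++ s2 ->
  exists c, [/\ x <= c <= y, wseg w x c = s1 & wseg w c y = s2].
Proof.
have [d] := ubnP (y - x); elim: d x s1 => // d IH x s1 dxy xy E.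
case: s1 => [|a s1] in E *; first by exists x; rewrite leqnn xy wseg_nil.
case: (ltngtP x y) xy => // [xy _|xy _]; last by rewrite wseg_nil ?xy in E.
move: E; rewrite wseg_recl //.
case E1: (letter w x) (size_letter w x) => [|b [|]] //= _.
  case/(IH x.+1 (a :: s1)) => //; first by lia.
  move=> c [/andP[xc cy] ? ?]; exists c; split=> //; first by rewrite (ltnW xc).
  by rewrite (wseg_recl _ xc) E1.
case=> <- /IH[||c [/andP[xc cy] Ec ?]] //; first by lia.
exists c; split=> //; first by rewrite (ltnW xc).
by rewrite (wseg_recl _ xc) E1 Ec.
Qed.

Lemma wseg_cons (Sigma : finType) (n : nat) (w : wstruct Sigma n) x y a s :
  wseg w x y = a :: s ->
  exists d, [/\ x <= d < y, wseg w x d = [::], letter w d = [:: a]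
             & wseg w d.+1 y = s].
Proof.
have [e] := ubnP (y - x); elim: e x => // e IH x exy.
have [yx|xy] := leqP y x; first by rewrite wseg_nil.
rewrite (wseg_recl _ xy).
case E1: (letter w x) (size_letter w x) => [|b [|]] //= _.
  case/IH=> [|d [/andP[xd dy] E2 E3 E4]]; first by lia.
  by exists d; split; rewrite // ?dy ?(ltnW xd) // (wseg_recl _ xd) E1.
by case=> <- <-; exists x; rewrite leqnn xy wseg_nil.
Qed.

Definition eq_factor (Sigma : finType) (n : nat) (w : wstruct Sigma n)
    (x y x' y' : nat) : Prop :=
  [/\ x <= y, x' <= y' & wseg w x y = wseg w x' y'].

Definition seg_run (Sigma : finType) (N : automaton (refsym Sigma))
    (q q' : astate N) (n : nat) (w : wstruct Sigma n) (x y : nat) : Prop :=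
  x <= y /\ run q (map (@Letter Sigma) (wseg w x y)) q'.

Lemma eq_factor_cut (Sigma : finType) (n : nat) (w : wstruct Sigma n)
    (x y x' y' : 'I_n.+1) (c : nat) :
  eq_factor w x y x' y' -> x <= c <= y ->
  exists c' : 'I_n.+1, eq_factor w x c x' c' /\ eq_factor w c y c' y'.
Proof.
case=> xy xy' E /andP[xc cy]; move: E; rewrite (wseg_cat w xc cy) => /esym/wseg_cut.
case=> // c' [/andP[? ?] ? ?].
have c'n : c' < n.+1 by apply: leq_ltn_trans (ltn_ord y').
by exists (Ordinal c'n).
Qed.

Lemma eq_factor_sym (Sigma : finType) (n : nat) (w : wstruct Sigma n) x y x' y' :
  eq_factor w x y x' y' -> eq_factor w x' y' x y.
Proof. by case. Qed.

Definition rel4 (n : nat) := 'I_n.+1 -> 'I_n.+1 -> 'I_n.+1 -> 'I_n.+1 -> Prop.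

(** One simultaneous cut of both intervals costs two quantifiers, so iterating it a fixed number of
    times stays first-order. *)
Definition cut_closure (n : nat) (R : rel4 n) : rel4 n := fun x y x' y' =>
  R x y x' y' \/ exists c c', R x c x' c' /\ R c y c' y'.

Section EqFactorUpdate.

Variables (Sigma : finType) (n : nat) (w : wstruct Sigma n) (o : update_op Sigma)
  (u : 'I_n.+1).

Let w' := update w o u.

Definition avoids (x y : nat) : Prop := u < x \/ y <= u.

Definition singleton (x y : nat) : Prop := x = u /\ y = u.+1.

(** In the mixed cases the condition speaks of the new word only, which makes it first-order without
    any stored relation. *)
Definition eq_factor_base (x y x' y' : nat) : Prop :=
  [\/ [/\ avoids x y, avoids x' y' & eq_factor w x y x' y'],
      singleton x y /\ singleton x' y',
      [/\ singleton x y, avoids x' y', x' <= y' &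
          wseg w' x' y' = seq_of_opt (op_letter o)]
    | [/\ singleton x' y', avoids x y, x <= y &
          wseg w' x y = seq_of_opt (op_letter o)]].

Lemma wseg_singleton x y :
  singleton x y -> wseg w' x y = seq_of_opt (op_letter o).
Proof. by case=> -> ->; rewrite wsegS letter_update eqxx. Qed.

Lemma eq_factor_base_sound x y x' y' :
  eq_factor_base x y x' y' -> eq_factor w' x y x' y'.
Proof.
case.
- by case=> ? ? [? ? E]; split; rewrite // !wseg_update.
- case=> S S'; split; last by rewrite !wseg_singleton.
    by case: S => -> ->.
  by case: S' => -> ->.
- by case=> S ? ? E; split; rewrite // ?(wseg_singleton S) //; case: S => -> ->.
- by case=> S ? ? E; split; rewrite // ?(wseg_singleton S) //; case: S => -> ->.
Qed.

Definition simple (x y : nat) : Prop := avoids x y \/ singleton x y.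

Lemma eq_factor_base_complete x y x' y' :
  eq_factor w' x y x' y' -> simple x y -> simple x' y' -> eq_factor_base x y x' y'.
Proof.
case=> xy xy' E [A|S] [A'|S'].
- by constructor 1; split=> //; split=> //; move: E; rewrite !wseg_update.
- by constructor 4; split=> //; rewrite -(wseg_singleton S').
- by constructor 3; split=> //; rewrite -(wseg_singleton S).
- by constructor 2.
Qed.

Lemma simple_sub x y c d : simple x y -> x <= c -> c <= d -> d <= y -> simple c d.
Proof. rewrite /simple /avoids /singleton; lia. Qed.

Lemma cut_closure_sound (R : rel4 n) :
  (forall x y x' y' : 'I_n.+1, R x y x' y' -> eq_factor w' x y x' y') ->
  forall x y x' y' : 'I_n.+1, cut_closure R x y x' y' -> eq_factor w' x y x' y'.
Proof.
move=> H x y x' y' [/H //|[c [c' [/H[? ? E1] /H[? ? E2]]]]].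
split; try by [apply: leq_trans; eassumption].
by rewrite (@wseg_cat _ _ _ _ c) // E1 E2 -wseg_cat.
Qed.

(* Two cuts of [x, y), at u and at u + 1, make all pieces simple. *)
Lemma cut_closure_complete (R : rel4 n) (good : nat -> nat -> Prop) :
  u != ord_max ->
  (forall x y c d, good x y -> x <= c -> c <= d -> d <= y -> good c d) ->
  (forall x y x' y' : 'I_n.+1, eq_factor w' x y x' y' -> simple x y -> good x' y' ->
    R x y x' y') ->
  forall x y x' y' : 'I_n.+1, eq_factor w' x y x' y' -> good x' y' ->
    cut_closure (cut_closure R) x y x' y'.
Proof.
move=> un gsub H x y x' y' E g.
(* Since [u] is not [$], the cut point [u + 1] is an element of the domain. *)
have su : u.+1 < n.+1.
  by rewrite ltnS ltn_neqAle -ltnS ltn_ord andbT; apply: contraNneq un => un;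
    apply/eqP/val_inj.
pose v := Ordinal su.
have [[? ? ?]] := E.
(* If the left end is at or after [u], the single cut at [u + 1] suffices; the cut at [u] is made
   after this case. *)
have step (a b a' b' : 'I_n.+1) : u <= a -> eq_factor w' a b a' b' -> good a' b' ->
    cut_closure R a b a' b'.
  move=> ua F ga; have [ab ab' _] := F.
  case: (leqP b u.+1) => bv; first by left;
    apply: H => //; rewrite /simple /avoids /singleton; lia.
  case: (leqP a u) => au; last by left;
    apply: H => //; rewrite /simple /avoids /singleton /=; lia.
  have [|c [F1 F2]] := eq_factor_cut (c := v) F; first by rewrite /=; lia.
  have [? ? _] := F1; have [? ? _] := F2.
  right; exists v, c; split; apply: H => //; try exact: gsub ga _ _ _.
    by rewrite /simple /avoids /singleton /=; lia.
  by rewrite /simple /avoids /singleton /=; lia.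
case: (leqP u x) => ux; first by left; apply: step.
case: (leqP y u) => yu; first by left; left; apply: H => //; left; right.
have [|c [F1 F2]] := eq_factor_cut (c := u) E; first by lia.
have [? ? _] := F1; have [? ? _] := F2.
right; exists u, c; split; last by apply: step => //; apply: gsub g _ _ _.
by left; apply: H => //; [left; right|apply: gsub g _ _ _].
Qed.

(** The outer two cuts make [[x, y)] simple; the inner two, with the roles exchanged, make
    [[x', y')] simple. *)
Definition eq_factor_step : rel4 n :=
  cut_closure (cut_closure (fun x y x' y' =>
    cut_closure (cut_closure (fun x y x' y' => eq_factor_base x y x' y'))
      x' y' x y)).

Lemma eq_factor_update : u != ord_max ->
  forall x y x' y' : 'I_n.+1, eq_factor w' x y x' y' <-> eq_factor_step x y x' y'.
Proof.
move=> un x y x' y'; split=> [E|].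
  (* The first round demands nothing of the second interval. In the next round [good] is [simple]:
     the interval already treated stays simple when it is cut again. *)
  apply: (cut_closure_complete (good := fun _ _ => True)) => // {E x y x' y'} x y x' y' E S _.
  apply: (cut_closure_complete (good := simple)) => //; first exact: simple_sub.
    by move=> ? ? ? ?; apply: eq_factor_base_complete.
  exact: eq_factor_sym.
do 2 apply: cut_closure_sound => {x y x' y'} x y x' y'.
move=> H; apply: eq_factor_sym; move: H.
do 2 apply: cut_closure_sound => {x y x' y'} x y x' y'.
exact: eq_factor_base_sound.
Qed.

(** After a reset the middle word is empty and the middle run just forces [q1 = q2], so one formula
    shape covers both kinds of update. *)
Lemma seg_run_update (N : automaton (refsym Sigma)) (q q' : astate N) (x y : nat) :
  seg_run q q' w' x y <->
  x <= y /\ avoids x y /\ seg_run q q' w x y \/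
  [/\ x <= u, u < y & exists q1 q2,
    [/\ seg_run q q1 w x u,
        run q1 (map (@Letter Sigma) (seq_of_opt (op_letter o))) q2
      & seg_run q2 q' w u.+1 y]].
Proof.
have cutE : x <= u -> u < y ->
    wseg w' x y = wseg w x u ++ seq_of_opt (op_letter o) ++ wseg w u.+1 y.
  move=> xu uy; rewrite (@wseg_cat _ _ _ x u) ?(ltnW uy) // (wseg_recl _ uy).
  by rewrite letter_update eqxx !wseg_update //; [left|right].
have avoidE : avoids x y -> wseg w' x y = wseg w x y.
  by move=> A; rewrite wseg_update.
split=> [[xy H]|[[xy [A [_ H]]]|]].
- have [xu|ux] := leqP x u; last first.
    by left; have A : avoids x y by [left]; rewrite avoidE // in H; do 2 (split=> //).
  have [uy|yu] := ltnP u y; last first.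
    by left; have A : avoids x y by [right]; rewrite avoidE // in H; do 2 (split=> //).
  right; split=> //; move: H; rewrite cutE // !map_cat.
  by move=> /run_cat[q1 ? /run_cat[q2 ? ?]]; exists q1, q2.
- by split; rewrite ?avoidE.
- case=> xu uy [q1 [q2 [[_ R1] R2 [_ R3]]]]; split; first by lia.
  rewrite cutE // !map_cat; apply/run_cat; exists q1 => //.
  by apply/run_cat; exists q2.
Qed.

End EqFactorUpdate.

(** * First-order definability *)

(* A shallow embedding of formulas: an element of [model n] determines a structure
   and an assignment of the free variables, and a property of such elements is
   definable if a single formula expresses it for all n. *)
Record context (Sigma : finType) (tau : signature) := Context {
  model :> nat -> Type;
  depth : nat;
  ctx_word : forall n, model n -> wstruct Sigma n;
  ctx_aux : forall n, model n -> aux_structure tau n;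
  ctx_env : forall n, model n -> depth.-tuple 'I_n.+1
}.

Section Definability.

Variables (Sigma : finType) (tau : signature).

Implicit Type G : context Sigma tau.

Definition ext G : context Sigma tau :=
  @Context Sigma tau (fun n => (G n * 'I_n.+1)%type) (depth G).+1
    (fun n c => ctx_word c.1) (fun n c => ctx_aux c.1)
    (fun n c => cons_tuple c.2 (ctx_env c.1)).

Definition point G := forall n, G n -> 'I_n.+1.

Definition is_term G (p : point G) : Prop :=
  exists t, forall n (c : G n), p n c = eval_term (ctx_env c) t.

Definition definable G (F : forall n, G n -> Prop) : Prop :=
  exists phi : formula Sigma tau (depth G),
    forall n (c : G n), eval (ctx_word c) (ctx_aux c) phi (ctx_env c) <-> F n c.

Lemma term_ext G (p : point G) :
  is_term p -> is_term (G := ext G) (fun n c => p n c.1).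
Proof.
case=> -[i|] H.
  exists (TVar (lift ord0 i)) => n c; rewrite H /=.
  by rewrite (tnth_nth ord_max) [RHS](tnth_nth ord_max).
by exists TEnd => n c; rewrite H.
Qed.

Lemma term_last G : is_term (G := ext G) (fun n c => c.2).
Proof. by exists (TVar ord0) => n c; rewrite /= (tnth_nth ord_max). Qed.

Lemma term_end G : is_term (G := G) (fun n c => ord_max).
Proof. by exists TEnd. Qed.

Lemma term_var G (i : 'I_(depth G)) : is_term (G := G) (fun n c => tnth (ctx_env c) i).
Proof. by exists (TVar i). Qed.

Lemma definable_iff G (F1 F2 : forall n, G n -> Prop) :
  (forall n c, F1 n c <-> F2 n c) -> definable F1 -> definable F2.
Proof. by move=> E [phi H]; exists phi => n c; rewrite H. Qed.

Lemma definable_not G (F : forall n, G n -> Prop) :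
  definable F -> definable (fun n c => ~ F n c).
Proof. by case=> phi H; exists (FNot phi) => n c; rewrite -H /=; split=> /negP. Qed.

Lemma definable_and G (F1 F2 : forall n, G n -> Prop) :
  definable F1 -> definable F2 -> definable (fun n c => F1 n c /\ F2 n c).
Proof.
case=> [p H] [q K]; exists (FAnd p q) => n c; rewrite -H -K /=.
by split=> /andP.
Qed.

Lemma definable_or G (F1 F2 : forall n, G n -> Prop) :
  definable F1 -> definable F2 -> definable (fun n c => F1 n c \/ F2 n c).
Proof.
case=> [p H] [q K]; exists (FOr p q) => n c; rewrite -H -K /=.
by split=> /orP.
Qed.

Lemma definable_and3 G (F1 F2 F3 : forall n, G n -> Prop) :
  definable F1 -> definable F2 -> definable F3 ->
  definable (fun n c => [/\ F1 n c, F2 n c & F3 n c]).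
Proof.
move=> D1 D2 D3; apply: definable_iff (definable_and D1 (definable_and D2 D3)) => n c.
by split=> [[? []]|[]].
Qed.

Lemma definable_and4 G (F1 F2 F3 F4 : forall n, G n -> Prop) :
  definable F1 -> definable F2 -> definable F3 -> definable F4 ->
  definable (fun n c => [/\ F1 n c, F2 n c, F3 n c & F4 n c]).
Proof.
move=> D1 D2 D3 D4.
apply: definable_iff (definable_and D1 (definable_and3 D2 D3 D4)) => n c.
by split=> [[? []]|[]].
Qed.

Lemma definable_or4 G (F1 F2 F3 F4 : forall n, G n -> Prop) :
  definable F1 -> definable F2 -> definable F3 -> definable F4 ->
  definable (fun n c => [\/ F1 n c, F2 n c, F3 n c | F4 n c]).
Proof.
move=> D1 D2 D3 D4.
apply: definable_iff (definable_or (definable_or D1 D2) (definable_or D3 D4)) => n c.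
by split=> [[[]|[]]|[]]; [constructor 1|constructor 2|constructor 3|constructor 4|
  left; left|left; right|right; left|right; right].
Qed.

(** The truth value is the same in all structures, so excluded middle selects the formula. This is
    how transitions of the automaton enter formulas. *)
Lemma definable_const G (A : Prop) : definable (G := G) (fun _ _ => A).
Proof.
have [a|na] := classic A; last by exists (FFalse _ _ _) => n c; split.
by exists (FNot (FFalse _ _ _)) => n c; split.
Qed.

Lemma definable_imply G (F1 F2 : forall n, G n -> Prop) :
  definable F1 -> definable F2 -> definable (fun n c => F1 n c -> F2 n c).
Proof.
move=> D1 D2; apply: definable_iff (definable_or (definable_not D1) D2) => n c.
by split=> [[]|] //; have [] := classic (F1 n c); tauto.
Qed.

Lemma definable_ex G (F : forall n, G n -> 'I_n.+1 -> Prop) :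
  definable (G := ext G) (fun n c => F n c.1 c.2) ->
  definable (fun n c => exists d, F n c d).
Proof.
case=> phi H; exists (FEx phi) => n c /=; split=> [/existsP[d Hd]|[d Fd]].
  by exists d; apply/(H n (c, d)).
by apply/existsP; exists d; apply/(H n (c, d)).
Qed.

Lemma definable_all G (F : forall n, G n -> 'I_n.+1 -> Prop) :
  definable (G := ext G) (fun n c => F n c.1 c.2) ->
  definable (fun n c => forall d, F n c d).
Proof.
case=> phi H; exists (FAll phi) => n c /=; split=> [/forallP Hd d|Fd].
  exact/(H n (c, d))/Hd.
by apply/forallP => d; apply/(H n (c, d)).
Qed.

Lemma definable_exfin G (T : finType) (F : T -> forall n, G n -> Prop) :
  (forall t, definable (F t)) -> definable (fun n c => exists t, F t n c).
Proof.
move=> D; suff: definable (fun n (c : G n) => exists2 t, t \in enum T & F t n c).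
  by apply: definable_iff => n c; split=> -[t]; exists t; rewrite ?mem_enum.
elim: (enum T) => [|t s IH].
  by apply: definable_iff (definable_const G False) => n c; split=> // -[].
apply: definable_iff (definable_or (D t) IH) => n c; split.
  case=> [?|[t' t's ?]]; first by exists t; rewrite ?mem_head.
  by exists t' => //; rewrite in_cons t's orbT.
by case=> t'; rewrite in_cons => /orP[/eqP ->|]; [left|right; exists t'].
Qed.

Lemma definable_all_in G (T : eqType) (s : seq T) (F : T -> forall n, G n -> Prop) :
  (forall t, t \in s -> definable (F t)) ->
  definable (fun n c => forall t, t \in s -> F t n c).
Proof.
elim: s => [|t s IH] D; first by apply: definable_iff (definable_const G True) => n c; split.
apply: definable_iff (definable_and (D t _) (IH _)); rewrite ?mem_head //.
  move=> n c; split=> [[? H] t'|H].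
    by rewrite in_cons => /orP[/eqP ->|/H].
  by split=> [|t' t's]; apply: H; rewrite in_cons ?eqxx // t's orbT.
by move=> t' t's; apply: D; rewrite in_cons t's orbT.
Qed.

Lemma definable_lt G (p q : point G) :
  is_term p -> is_term q -> definable (fun n c => p n c < q n c).
Proof. by case=> t H [t' H']; exists (FLt _ _ t t') => n c /=; rewrite H H'. Qed.

Lemma definable_eq G (p q : point G) :
  is_term p -> is_term q -> definable (fun n c => p n c = q n c).
Proof.
case=> t H [t' H']; exists (FEq _ _ t t') => n c /=; rewrite H H'.
by split=> /eqP.
Qed.

Lemma definable_le G (p q : point G) :
  is_term p -> is_term q -> definable (fun n c => p n c <= q n c).
Proof.
move=> Hp Hq; apply: definable_iff (definable_not (definable_lt Hq Hp)) => n c.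
by rewrite [X in _ <-> is_true X]leqNgt; split=> /negP.
Qed.

(** Formulas have only the order, so the successor is defined as the least larger element. *)
Lemma definable_succ G (p q : point G) :
  is_term p -> is_term q -> definable (fun n c => (p n c).+1 = q n c).
Proof.
move=> Hp Hq; apply: (definable_iff (F1 := fun n c => p n c < q n c /\
  forall d : 'I_n.+1, p n c < d -> q n c <= d)).
  move=> n c; split=> [[lt H]|<-]; last by split.
  have pn : (p n c).+1 < n.+1 by apply: leq_ltn_trans lt (ltn_ord _).
  by apply/eqP; rewrite eqn_leq lt; apply: (H (Ordinal pn)).
apply: definable_and; first exact: definable_lt.
apply: definable_all; apply: definable_imply; last exact/definable_le/term_last/term_ext.
by apply: definable_lt; [apply: term_ext|apply: term_last].
Qed.

Lemma definable_letter G (p : point G) (a : option Sigma) :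
  is_term p -> definable (fun n c => ctx_word c (p n c) = a).
Proof.
have D b : is_term p -> definable (fun n (c : G n) => ctx_word c (p n c) = Some b).
  case=> t H; exists (FLetter _ b t) => n c /=; rewrite H.
  by split=> /eqP.
move=> Hp; case: a => [a|]; first exact: D.
apply: definable_iff (definable_not (definable_exfin (fun b => D b Hp))) => n c.
by case: (ctx_word c _) => [b|]; split=> // H; [case: H; exists b|case].
Qed.

(** The filtered list depends on the structure but takes finitely many values: the formula
    distinguishes cases on each test and ends with a fixed list. *)
Lemma definable_filter G (T : Type) (s : seq T) (P : T -> forall n, G n -> bool)
    (F : seq T -> forall n, G n -> Prop) :
  (forall t, definable (fun n c => P t n c)) -> (forall s, definable (F s)) ->
  definable (fun n c => F [seq t <- s | P t n c] n c).
Proof.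
move=> DP; elim: s F => [|t s IH] F DF; first exact: DF.
apply: (definable_iff (F1 := fun n c =>
  P t n c /\ F (t :: [seq t <- s | P t n c]) n c \/
  ~ P t n c /\ F [seq t <- s | P t n c] n c)).
  by move=> n c /=; case: (P t n c); split; [case=> -[]|left|case=> -[]|right].
by apply: definable_or; apply: definable_and => //;
  [apply: (IH (fun s => F (t :: s)))|apply: definable_not|apply: IH].
Qed.

End Definability.

Arguments definable {Sigma tau} G F.
Arguments is_term {Sigma tau} G p.

(** Passing under a quantifier: hypotheses that points are terms move to the extended context, and
    the new variable is added as a term. *)
Ltac weaken :=
  repeat match goal with
  | H : is_term ?G ?p |- definable (ext ?G) _ =>
      apply (@term_ext _ _ G p) in H; cbv beta in H
  | H : (forall x, is_term ?G (@?p x)) |- definable (ext ?G) _ =>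
      let H' := fresh in
      assert (H' := fun x => @term_ext _ _ G (p x) (H x)); cbv beta in H';
      clear H; rename H' into H
  end;
  match goal with
  | |- definable (ext ?G) _ => let H := fresh "Hlast" in
      assert (H := @term_last _ _ G)
  end.

Ltac defin1 :=
  match goal with
  | |- definable _ (fun n c => _ /\ _) => apply: definable_and
  | |- definable _ (fun n c => [/\ _, _ & _]) => apply: definable_and3
  | |- definable _ (fun n c => [/\ _, _, _ & _]) => apply: definable_and4
  | |- definable _ (fun n c => [\/ _, _, _ | _]) => apply: definable_or4
  | |- definable _ (fun n c => _ \/ _) => apply: definable_or
  | |- definable _ (fun n c => ~ _) => apply: definable_not
  | |- definable _ (fun n c => exists d : ordinal _, _) => apply: definable_ex; weaken
  | |- definable _ (fun n c => forall d : ordinal _, _) => apply: definable_all; weaken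
  | |- definable _ (fun n c => exists q : Finite.sort ?T, _) =>
       apply: definable_exfin => ?
  | |- definable _ (fun n c => _ -> _) => apply: definable_imply
  end.

(** Works by recursion on the shape of the property; what remains are the relations without a
    built-in case. *)
Ltac defin :=
  repeat first
    [ defin1
    | assumption
    | match goal with
      | |- is_term _ (fun n c => ord_max) => apply: term_end
      | |- definable _ (fun n c => is_true (leq (S _) _)) => apply: definable_lt
      | |- definable _ (fun n c => is_true (leq _ _)) => apply: definable_le
      | |- definable _ (fun n c => S _ = _) => apply: definable_succ
      | |- definable _ (fun n c => _ = _ :> ordinal _) => apply: definable_eq
      | |- definable ?G (fun n c => fun_of_fin _ (@?p n c) = ?a) =>
          apply (@definable_letter _ _ G p a)
      | |- definable _ (fun n c => ?A) => apply: definable_const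
      end ].

(** * The auxiliary relations *)

(** The word is empty if no element of the interval carries a letter; it is the single letter [a] if
    some element carries [a] and the intervals on both sides of it have empty words. *)
Lemma definable_wseg_opt (Sigma : finType) (tau : signature)
    (G : context Sigma tau) (p q : point G) (a : option Sigma) :
  is_term G p -> is_term G q ->
  definable G (fun n c => p n c <= q n c /\
                          wseg (ctx_word c) (p n c) (q n c) = seq_of_opt a).
Proof.
have nil (D : context Sigma tau) (r s : point D) : is_term D r -> is_term D s ->
    definable D (fun n c => r n c <= s n c /\
                            wseg (ctx_word c) (r n c) (s n c) = [::]).
  move=> Hr Hs.
  apply: (@definable_iff _ _ D (fun n c => r n c <= s n c /\
    forall d : 'I_n.+1, r n c <= d -> d < s n c -> ctx_word c d = None)).
    move=> n c; split=> -[le H]; split=> //.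
      suff gen e i : r n c <= i -> s n c - i < e -> wseg (ctx_word c) i (s n c) = [::].
        exact: gen (leqnn _) (ltnSn _).
      elim: e i => // e IH i ri ie.
      have [si|is_] := leqP (s n c) i; first by rewrite wseg_nil.
      have iN : i < n.+1 by apply: ltn_trans is_ (ltn_ord _).
      rewrite wseg_recl // (letter_ord _ (Ordinal iN)) H //=; apply: IH; lia.
    move=> d rd ds; move: H; rewrite (@wseg_cat _ _ _ _ d) ?(ltnW ds) // (wseg_recl _ ds).
    by rewrite letter_ord; case: (ctx_word c d) => // b /(congr1 size);
      rewrite size_cat /= addnS.
  defin.
case: a => [a|] Hp Hq; last exact: nil.
apply: (@definable_iff _ _ G (fun n c => exists d d' : 'I_n.+1,
  [/\ ctx_word c d = Some a, d.+1 = d',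
   p n c <= d /\ wseg (ctx_word c) (p n c) d = [::]
   & d' <= q n c /\ wseg (ctx_word c) d' (q n c) = [::]])).
  move=> n c; split=> [[d [d' [da dd' [pd E1] [d'q E2]]]]|[pq E]].
    have dq : d < q n c by rewrite dd'.
    split; first by rewrite (leq_trans pd) // ltnW.
    rewrite (@wseg_cat _ _ _ _ d) ?(ltnW dq) // E1 (wseg_recl _ dq) letter_ord da /=.
    by rewrite dd' E2.
  have [d [/andP[pd dq] E1 E2 E3]] := wseg_cons E.
  have dn : d < n.+1 by apply: ltn_trans dq (ltn_ord _).
  have d'n : d.+1 < n.+1 by apply: leq_ltn_trans dq (ltn_ord _).
  exists (Ordinal dn), (Ordinal d'n); split=> //.
  by move: E2; rewrite (letter_ord _ (Ordinal dn)); case: (ctx_word c _) => // b [->].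
do 2 (apply: definable_ex; weaken).
apply: definable_and4; [defin|defin|exact: nil|exact: nil].
Qed.

Section Base.

Variables (Sigma : finType) (N : automaton (refsym Sigma)).

Record base_definable (tau : signature) (G : context Sigma tau) : Prop := {
  base_end : forall n (c : G n), ctx_word c ord_max = None;
  base_eq_factor : forall p q p' q' : point G,
    is_term G p -> is_term G q -> is_term G p' -> is_term G q' ->
    definable G (fun n c =>
      eq_factor (ctx_word c) (p n c) (q n c) (p' n c) (q' n c));
  base_seg_run : forall (s s' : astate N) (p q : point G),
    is_term G p -> is_term G q ->
    definable G (fun n c => seg_run s s' (ctx_word c) (p n c) (q n c))
}.

(* Formulas under quantifiers live in iterated extensions of a context, so the
   base relations must be definable in all of these. *)
Definition supports (tau : signature) (G : context Sigma tau) : Prop :=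
  exists K : context Sigma tau -> Prop,
    [/\ K G, forall D, K D -> K (ext D) & forall D, K D -> base_definable D].

Lemma supports_ext tau (G : context Sigma tau) : supports G -> supports (ext G).
Proof. by case=> K [KG Kext Kbase]; exists K; split=> //; apply: Kext. Qed.

Lemma supports_base tau (G : context Sigma tau) : supports G -> base_definable G.
Proof. by case=> K [KG _]; apply. Qed.

(** All words are empty here, so the two relations reduce to comparisons of interval ends and, for
    runs, equality of the states. *)
Lemma supports_empty tau (G : context Sigma tau) :
  (forall n (c : G n), ctx_word c = empty_wstruct Sigma n) -> supports G.
Proof.
move=> H; exists (fun D : context Sigma tau => forall n (c : D n),
  ctx_word c = empty_wstruct Sigma n).
split=> //; first by move=> D HD n c; apply: HD.
move=> D HD; split=> [n c|p q p' q' *|s s' p q *].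
- by rewrite HD ffunE.
- apply: (@definable_iff _ _ D (fun n c => p n c <= q n c /\ p' n c <= q' n c)).
    by move=> n c; rewrite /eq_factor HD !wseg_empty; split=> -[].
  by defin.
- apply: (@definable_iff _ _ D (fun n c => p n c <= q n c /\ s = s')).
    by move=> n c; rewrite /seg_run HD wseg_empty.
  by defin.
Qed.

(** [None] names the relation to be maintained, [Some None] the equality of factors, and
    [Some (Some (s, s'))] the runs from [s] to [s']. *)
Definition prog_sig (m : nat) : signature :=
  @Signature (option (option (astate N * astate N)))
    (fun R => match R with None => m | Some None => 4 | Some (Some _) => 2 end).

Definition prog_rel (m : nat) (Q : word_relation Sigma m) (n : nat)
    (w : wstruct Sigma n) (R : sym (prog_sig m)) :
    (arity R).-tuple 'I_n.+1 -> Prop :=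
  match R with
  | None => Q n w
  | Some None => fun x =>
      eq_factor w (tnth x (inord 0)) (tnth x (inord 1)) (tnth x (inord 2))
        (tnth x (inord 3))
  | Some (Some (s, s')) => fun x => seg_run s s' w (tnth x ord0) (tnth x ord_max)
  end.

(** Formulas read the updated word directly and the old one through the auxiliary relations; [old]
    itself is not part of the structure. *)
Record update_context (m : nat) (Q : word_relation Sigma m) (o : update_op Sigma)
    (G : context Sigma (prog_sig m)) (old : forall n, G n -> wstruct Sigma n)
    (u : point G) : Prop := {
  upd_term : is_term G u;
  upd_word : forall n (c : G n), ctx_word c = update (old n c) o (u n c);
  upd_ne : forall n (c : G n), u n c != ord_max;
  upd_end : forall n (c : G n), old n c ord_max = None;
  upd_aux : forall n (c : G n) R (x : (arity R).-tuple 'I_n.+1),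
    ctx_aux c x <-> prog_rel Q (old n c) x
}.

(** * First-order update of the base relations *)

Section Update.

Variables (m : nat) (Q : word_relation Sigma m) (o : update_op Sigma).

(** Quantifying over all update contexts makes the notion usable inside extensions, where the
    quantified cut points live. *)
Definition update_definable4
    (R : forall n, wstruct Sigma n -> 'I_n.+1 -> rel4 n) : Prop :=
  forall G old u, update_context Q o old u -> forall p q p' q' : point G,
    is_term G p -> is_term G q -> is_term G p' -> is_term G q' ->
    definable G (fun n c => R n (old n c) (u n c) (p n c) (q n c) (p' n c) (q' n c)).

Lemma update_context_ext G old u : @update_context m Q o G old u ->
  @update_context m Q o (ext G) (fun n c => old n c.1) (fun n c => u n c.1).
Proof.
case=> H1 H2 H3 H4 H5; split.
- exact: term_ext.
- by move=> n c; apply: H2.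
- by move=> n c; apply: H3.
- by move=> n c; apply: H4.
- by move=> n c; apply: H5.
Qed.

Lemma update_definable_cut R :
  update_definable4 R -> update_definable4 (fun n w u => cut_closure (R n w u)).
Proof.
move=> DR G old u U p q p' q' *; rewrite /cut_closure; defin; first exact: DR.
all: exact: (DR _ _ _ (update_context_ext (update_context_ext U))).
Qed.

Lemma definable_aux_eq_factor G old u p q p' q' :
  @update_context m Q o G old u ->
  is_term G p -> is_term G q -> is_term G p' -> is_term G q' ->
  definable G (fun n c =>
    eq_factor (old n c) (p n c) (q n c) (p' n c) (q' n c)).
Proof.
move=> U [t1 H1] [t2 H2] [t3 H3] [t4 H4].
exists (@FRel Sigma (prog_sig m) _ (Some None) [tuple t1; t2; t3; t4]) => n c.
rewrite [X in is_true X](_ : _ = ctx_aux c (R := Some None)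
  [tuple p n c; q n c; p' n c; q' n c]).
  by rewrite (upd_aux U) /= !(tnth_nth ord_max) /= !inordK.
by rewrite /= H1 H2 H3 H4; congr ctx_aux; apply: val_inj.
Qed.

Lemma definable_aux_seg_run G old u (s s' : astate N) p q :
  @update_context m Q o G old u -> is_term G p -> is_term G q ->
  definable G (fun n c => seg_run s s' (old n c) (p n c) (q n c)).
Proof.
move=> U [t1 H1] [t2 H2].
exists (@FRel Sigma (prog_sig m) _ (Some (Some (s, s'))) [tuple t1; t2]) => n c.
rewrite [X in is_true X](_ : _ = ctx_aux c (R := Some (Some (s, s')))
  [tuple p n c; q n c]).
  by rewrite (upd_aux U) /= !(tnth_nth ord_max).
by rewrite /= H1 H2; congr ctx_aux; apply: val_inj.
Qed.

Lemma update_definable_base :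
  update_definable4 (fun n w u x y x' y' => eq_factor_base w o u x y x' y').
Proof.
move=> G old u U.
have singl p q : is_term G p -> is_term G q ->
    definable G (fun n c => singleton (u n c) (p n c) (q n c)).
  move=> Hp Hq; have Hu := upd_term U.
  apply: (@definable_iff _ _ G (fun n c => p n c = u n c /\ (u n c).+1 = q n c)).
    move=> n c; rewrite /singleton.
    by split=> [[-> ->]|[E ->]] //; split=> //; apply: val_inj.
  by defin.
have avoid p q : is_term G p -> is_term G q ->
    definable G (fun n c => avoids (u n c) (p n c) (q n c)).
  by move=> Hp Hq; have Hu := upd_term U; rewrite /avoids; defin.
have opt p q : is_term G p -> is_term G q ->
    definable G (fun n c => p n c <= q n c /\
      wseg (update (old n c) o (u n c)) (p n c) (q n c) =
        seq_of_opt (op_letter o)).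
  move=> Hp Hq; apply: definable_iff (definable_wseg_opt (op_letter o) Hp Hq).
  by move=> n c; rewrite (upd_word U).
move=> p q p' q' Hp Hq Hp' Hq'.
apply: (@definable_iff _ _ G (fun n c =>
 [\/ [/\ avoids (u n c) (p n c) (q n c), avoids (u n c) (p' n c) (q' n c)
      & eq_factor (old n c) (p n c) (q n c) (p' n c) (q' n c)],
    singleton (u n c) (p n c) (q n c) /\ singleton (u n c) (p' n c) (q' n c),
    [/\ singleton (u n c) (p n c) (q n c), avoids (u n c) (p' n c) (q' n c)
      & p' n c <= q' n c /\ wseg (update (old n c) o (u n c)) (p' n c) (q' n c) =
          seq_of_opt (op_letter o)]
  | [/\ singleton (u n c) (p' n c) (q' n c), avoids (u n c) (p n c) (q n c)
      & p n c <= q n c /\ wseg (update (old n c) o (u n c)) (p n c) (q n c) =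
          seq_of_opt (op_letter o)]])).
  move=> n c; split=> -[H|H|H|H].
  - by constructor 1.
  - by constructor 2.
  - by constructor 3; case: H => ? ? [].
  - by constructor 4; case: H => ? ? [].
  - by constructor 1.
  - by constructor 2.
  - by constructor 3; case: H.
  - by constructor 4; case: H.
apply: definable_or4; [|apply: definable_and| |]; try apply: definable_and3; auto.
exact: (definable_aux_eq_factor U).
Qed.

Lemma update_definable_step :
  update_definable4 (fun n w u => eq_factor_step w o u).
Proof.
have D2 : update_definable4 (fun n w u => cut_closure (cut_closure
    (fun x y x' y' => eq_factor_base w o u x y x' y'))).
  by do 2 apply: update_definable_cut; apply: update_definable_base.
rewrite /eq_factor_step; do 2 apply: update_definable_cut.
by move=> G old u U p q p' q' Hp Hq Hp' Hq'; apply: (D2 _ _ _ U).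
Qed.

(** The class of all update contexts witnesses [supports]: it is closed under extension, and the
    recomposition formulas define both relations of the new word. *)
Lemma supports_update G old u : @update_context m Q o G old u -> supports G.
Proof.
exists (fun D => exists old u, @update_context m Q o D old u).
split; first by exists old, u.
  by move=> D [old' [u' U]]; do 2 eexists; apply: update_context_ext U.
move=> {G old u H}D [old [u U]].
split=> [n c|p q p' q' Hp Hq Hp' Hq'|s s' p q Hp Hq].
- by rewrite (upd_word U) ffunE eq_sym (negbTE (upd_ne U c)) (upd_end U).
- apply: definable_iff (update_definable_step U Hp Hq Hp' Hq') => n c.
  by rewrite (upd_word U) (eq_factor_update _ _ (upd_ne U c)).
- have Hu := upd_term U.
  (* The successor of [u] is not a term, so it is introduced as a quantified [v], which exists
     because [u < q]. *)
  apply: (@definable_iff _ _ D (fun n c =>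
    p n c <= q n c /\ avoids (u n c) (p n c) (q n c) /\
      seg_run s s' (old n c) (p n c) (q n c) \/
    [/\ p n c <= u n c, u n c < q n c & exists (v : 'I_n.+1), (u n c).+1 = v /\
      exists q1, exists q2,
        [/\ seg_run s q1 (old n c) (p n c) (u n c),
         run q1 (map (@Letter Sigma) (seq_of_opt (op_letter o))) q2
         & seg_run q2 s' (old n c) v (q n c)]])).
    move=> n c; rewrite (upd_word U) seg_run_update; split=> -[?|[pu uq H]]; try by left.
      by right; split=> //; case: H => v [-> H].
    right; split=> //; have vn := leq_ltn_trans uq (ltn_ord _).
    by exists (Ordinal vn).
  have U' := update_context_ext U.
  rewrite /avoids; defin; first exact: (definable_aux_seg_run _ _ U).
  all: exact: (definable_aux_seg_run _ _ U').
Qed.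

End Update.

End Base.

(** * Runs over words with brackets *)

Section Blocks.

Variables (Sigma : finType) (n : nat) (w : wstruct Sigma n).

Implicit Types (L r : seq (refsym Sigma)) (pt : refsym Sigma -> 'I_n.+1).

Definition brackets_at pt L (x : nat) := [seq b <- L | pt b == x :> nat].

Arguments brackets_at : simpl never.

(* Ref-words for the letters in [x, x + d) in which each bracket b of L is read
   at the element pt b, just before the letter of that element. *)
Fixpoint blocks pt L (x d : nat) r : Prop :=
  if d is d'.+1 then
    exists s r', [/\ perm_eq s (brackets_at pt L x),
                     r = s ++ map (@Letter Sigma) (letter w x) ++ r'
                   & blocks pt L x.+1 d' r']
  else r = [::].

Lemma blocks_cat pt L x d1 d2 r :
  blocks pt L x (d1 + d2) r <->
  exists r1 r2, [/\ r = r1 ++ r2, blocks pt L x d1 r1 & blocks pt L (x + d1) d2 r2].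
Proof.
elim: d1 x r => [|d1 IH] x r /=.
  rewrite addn0; split=> [H|[_ [r2 [-> -> //]]]].
  by exists [::], r.
split=> [[s [r' [ps -> /IH[r1 [r2 [-> B1 B2]]]]]]|].
  exists (s ++ map (@Letter Sigma) (letter w x) ++ r1), r2.
  by rewrite -!catA -addSnnS; split=> //; exists s, r1.
case=> _ [r2 [-> [s [r1 [ps -> B1]]] B2]].
exists s, (r1 ++ r2); rewrite -!catA; split=> //.
by apply/IH; exists r1, r2; rewrite -addSnnS in B2.
Qed.

Lemma blocks_nil pt x d r :
  blocks pt [::] x d r <-> r = map (@Letter Sigma) (wseg w x (x + d)).
Proof.
elim: d x r => [|d IH] x r /=; first by rewrite wseg_nil ?addn0.
rewrite wseg_recl; last by lia.
rewrite map_cat -addSnnS; split=> [[s [r' [/perm_nilP -> -> /IH -> //]]]|->].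
by exists [::]; eexists; split; last exact/IH.
Qed.

Lemma blocks_cons_avoid pt b L x d r : pt b < x \/ x + d <= pt b ->
  blocks pt (b :: L) x d r <-> blocks pt L x d r.
Proof.
elim: d x r => //= d IH x r H.
have E : brackets_at pt (b :: L) x = brackets_at pt L x.
  by rewrite /brackets_at /=; case: eqP => // Ex; lia.
have H' : pt b < x.+1 \/ x.+1 + d <= pt b by lia.
rewrite E.
by split=> -[s [r' [ps -> /(IH _ _ H') B]]]; exists s, r'.
Qed.

Variable N : automaton (refsym Sigma).

Implicit Type s : astate N.

Definition block_run pt L s s' (x y : nat) : Prop :=
  x <= y /\ exists2 r, blocks pt L x (y - x) r & run s r s'.

Definition block_step pt L s s' (x : nat) : Prop :=
  exists2 t, perm_eq t (brackets_at pt L x) &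
    run s (t ++ map (@Letter Sigma) (letter w x)) s'.

Lemma block_run_nil pt s s' x y :
  block_run pt [::] s s' x y <-> seg_run s s' w x y.
Proof.
rewrite /block_run /seg_run.
split=> -[xy H]; split=> //; first by case: H => r /blocks_nil ->; rewrite subnKC.
by eexists; [apply/blocks_nil; reflexivity|rewrite subnKC].
Qed.

Lemma block_run1 pt L s s' x : block_run pt L s s' x x.+1 <-> block_step pt L s s' x.
Proof.
rewrite /block_run /block_step subSnn /=.
split=> [[_ [r [t [r' [pt_ -> ->]]]]]|[t pt_ R]].
  by rewrite cats0; exists t.
split=> //; exists (t ++ map (@Letter Sigma) (letter w x)) => //.
by exists t, [::]; rewrite cats0.
Qed.

Lemma block_run_cat pt L s s' x y z : x <= y -> y <= z ->
  block_run pt L s s' x z <->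
  exists2 q, block_run pt L s q x y & block_run pt L q s' y z.
Proof.
move=> xy yz; rewrite /block_run.
have -> : z - x = (y - x) + (z - y) by lia.
split=> [[_ [r /blocks_cat[r1 [r2 [-> B1 B2]]] /run_cat[q R1 R2]]]|].
  by exists q; split=> //; [exists r1|exists r2; rewrite ?subnKC // in B2 *].
case=> q [_ [r1 B1 R1]] [_ [r2 B2 R2]]; split; first exact: leq_trans yz.
exists (r1 ++ r2); last by apply/run_cat; exists q.
by apply/blocks_cat; exists r1, r2; rewrite subnKC.
Qed.

Lemma block_run_cons_avoid pt b L s s' x y : pt b < x \/ y <= pt b ->
  block_run pt (b :: L) s s' x y <-> block_run pt L s s' x y.
Proof.
move=> H; rewrite /block_run.
split=> -[xy [r B R]]; split=> //; exists r => //; apply/(blocks_cons_avoid (b := b)).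
all: by rewrite ?subnKC //.
Qed.

(** Removing brackets one by one reduces [block_run] to [seg_run]. Only the step at [pt b] keeps the
    full list, as further brackets may sit at the same element. *)
Lemma block_run_cons pt b L s s' x y :
  block_run pt (b :: L) s s' x y <->
  (pt b < x \/ y <= pt b) /\ block_run pt L s s' x y \/
  [/\ x <= pt b, pt b < y & exists q1 q2,
    [/\ block_run pt L s q1 x (pt b), block_step pt (b :: L) q1 q2 (pt b)
      & block_run pt L q2 s' (pt b).+1 y]].
Proof.
have cut q q' : x <= pt b -> pt b < y -> block_run pt (b :: L) q q' x y <->
    exists q1 q2, [/\ block_run pt L q q1 x (pt b), block_step pt (b :: L) q1 q2 (pt b)
      & block_run pt L q2 q' (pt b).+1 y].
  move=> xb bY; rewrite (block_run_cat _ _ _ _ xb (ltnW bY)); split.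
    case=> q1 /block_run_cons_avoid R1.
    move=> /(block_run_cat _ _ _ _ (leqnSn _) bY)[q2 /block_run1 R2 /block_run_cons_avoid R3].
    by exists q1, q2; split=> //; [apply: R1; right|apply: R3; left].
  case=> q1 [q2 [R1 R2 R3]]; exists q1; first by apply/block_run_cons_avoid => //; right.
  apply/(block_run_cat _ _ _ _ (leqnSn _) bY).
  by exists q2; [apply/block_run1|apply/block_run_cons_avoid => //; left].
split=> [H|[[A R]|[xb bY]]]; last by move=> ?; apply/cut.
  have [xb|bx] := leqP x (pt b); last first.
    by left; split; [left|apply/(block_run_cons_avoid (b := b)) => //; left].
  have [bY|yb] := ltnP (pt b) y; last first.
    by left; split; [right|apply/(block_run_cons_avoid (b := b)) => //; right].
  by right; split=> //; apply/cut.
exact/block_run_cons_avoid.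
Qed.

End Blocks.

Arguments brackets_at : simpl never.

Section DefinableBlocks.

Variables (Sigma : finType) (N : automaton (refsym Sigma)) (tau : signature).

(** Once it is decided which brackets sit at [p] and which letter it carries, the existence of a
    suitable run is a constant. *)
Lemma definable_block_step (G : context Sigma tau)
    (pt : refsym Sigma -> point G) L (s s' : astate N) (p : point G) :
  (forall b, is_term G (pt b)) -> is_term G p ->
  definable G (fun n c =>
    block_step (ctx_word c) (fun b => pt b n c) L s s' (p n c)).
Proof.
move=> Hpt Hp; rewrite /block_step /brackets_at.
apply: (@definable_filter _ _ _ _ L (fun b n c => pt b n c == p n c :> nat)
  (fun S n c => exists2 t, perm_eq t S &
    run s (t ++ map (@Letter Sigma) (letter (ctx_word c) (p n c))) s')).
  move=> b; apply: definable_iff (definable_eq (Hpt b) Hp) => n c.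
  by split=> [->|/eqP/val_inj].
move=> S; apply: (@definable_iff _ _ G (fun n c => exists a : option Sigma,
  ctx_word c (p n c) = a /\ exists2 t, perm_eq t S &
    run s (t ++ map (@Letter Sigma) (seq_of_opt a)) s')).
  move=> n c; rewrite letter_ord; split=> [[a [<-]] //|H].
  by exists (ctx_word c (p n c)).
by apply: (definable_exfin (T := option Sigma)) => a; defin.
Qed.

Lemma definable_block_run L (G : context Sigma tau)
    (pt : refsym Sigma -> point G) (s s' : astate N) (p q : point G) :
  supports N G -> (forall b, is_term G (pt b)) -> is_term G p -> is_term G q ->
  definable G (fun n c =>
    block_run (ctx_word c) (fun b => pt b n c) L s s' (p n c) (q n c)).
Proof.
elim: L G pt s s' p q => [|b L IH] G pt s s' p q SG Hpt Hp Hq.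
  apply: definable_iff (base_seg_run (supports_base SG) s s' Hp Hq) => n c.
  by rewrite block_run_nil.
apply: (@definable_iff _ _ G (fun n c =>
  (pt b n c < p n c \/ q n c <= pt b n c) /\
    block_run (ctx_word c) (fun b => pt b n c) L s s' (p n c) (q n c) \/
  [/\ p n c <= pt b n c, pt b n c < q n c &
    exists v : 'I_n.+1, (pt b n c).+1 = v /\ exists q1, exists q2,
    [/\ block_run (ctx_word c) (fun b => pt b n c) L s q1 (p n c) (pt b n c),
      block_step (ctx_word c) (fun b => pt b n c) (b :: L) q1 q2 (pt b n c)
      & block_run (ctx_word c) (fun b => pt b n c) L q2 s' v (q n c)]])).
  move=> n c; rewrite block_run_cons; split=> -[H|[H1 H2 H]]; try by left.
    by right; split=> //; case: H => v [-> H].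
  right; split=> //.
  by exists (Ordinal (leq_ltn_trans H2 (ltn_ord _))).
have Hb := Hpt b; have SG' := supports_ext SG.
defin; first exact: IH.
- exact: (IH (ext G) (fun b n c => pt b n c.1)).
- exact: (@definable_block_step (ext G) (fun b n c => pt b n c.1)).
- exact: (IH (ext G) (fun b n c => pt b n c.1)).
Qed.

End DefinableBlocks.

(** * Ref-words and positions *)

Definition is_bracket (Sigma : finType) (b : refsym Sigma) : bool :=
  if b is Letter _ then false else true.

Lemma uniq_count_le1 (T : eqType) (s : seq T) :
  (forall x, x \in s -> count_mem x s <= 1) -> uniq s.
Proof.
move=> H; apply: count_mem_uniq => x; have [xs|/count_memPn //] := boolP (x \in s).
by apply/eqP; rewrite eqn_leq H // -has_count has_pred1.
Qed.

Section RefWords.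

Variable Sigma : finType.

Implicit Types (r s : seq (refsym Sigma)) (b : refsym Sigma).

Lemma clr_cat r1 r2 : clr (r1 ++ r2) = clr r1 ++ clr r2.
Proof. exact: pmap_cat. Qed.

Lemma clr_letters (v : seq Sigma) : clr (map (@Letter Sigma) v) = v.
Proof. by elim: v => //= a v ->. Qed.

Lemma clr_brackets s : all (@is_bracket Sigma) s -> clr s = [::].
Proof. by elim: s => //= -[a|x|x] s IH //=. Qed.

Lemma clr_nil r : clr r = [::] -> all (@is_bracket Sigma) r.
Proof. by elim: r => //= -[a|x|x] s IH //=. Qed.

Lemma clr_cons r a v : clr r = a :: v ->
  exists s r', [/\ r = s ++ Letter a :: r', all (@is_bracket Sigma) s & clr r' = v].
Proof.
elim: r => //= -[b|x|x] r IH /=.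
- by case=> -> <-; exists [::], r.
- by move=> /IH[s [r' [-> ? ?]]]; exists (Open x :: s), r'.
- by move=> /IH[s [r' [-> ? ?]]]; exists (Close x :: s), r'.
Qed.

Lemma take_index_catl b s r :
  b \in s -> take (index b (s ++ r)) (s ++ r) = take (index b s) s.
Proof. by move=> bs; rewrite index_cat bs takel_cat // index_size. Qed.

Lemma take_index_catr b s r :
  b \notin s -> take (index b (s ++ r)) (s ++ r) = s ++ take (index b r) r.
Proof.
move=> bs; rewrite index_cat (negbTE bs) take_cat.
by rewrite ltnNge leq_addr /= addKn.
Qed.

Lemma bracket_notin_letters b (v : seq Sigma) :
  is_bracket b -> b \notin map (@Letter Sigma) v.
Proof. by case: b => // x _; apply/mapP => -[]. Qed.

Lemma clr_take_brackets s k : all (@is_bracket Sigma) s -> clr (take k s) = [::].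
Proof.
move=> /allP H; apply: clr_brackets; apply/allP => b bs; apply: H.
exact: mem_take bs.
Qed.

(** Together with functionality this pins down the brackets of a ref-word: exactly those of
    [rvars g], each once. *)
Lemma bracket_in_rvars (g : regex Sigma) r b : ref_lang g r -> is_bracket b ->
  b \in r -> exists2 x, x \in rvars g & b = Open x \/ b = Close x.
Proof.
move=> H B; elim: H => {g r}.
- by [].
- by move=> a; rewrite inE => /eqP E; rewrite E in B.
- by move=> g1 g2 r _ IH /IH[x xg E]; exists x; rewrite //= in_fsetU xg.
- by move=> g1 g2 r _ IH /IH[x xg E]; exists x; rewrite //= in_fsetU xg orbT.
- move=> g1 g2 r1 r2 _ IH1 _ IH2; rewrite mem_cat => /orP[/IH1|/IH2] [x xg E];
    by exists x; rewrite //= in_fsetU xg ?orbT.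
- by [].
- move=> g r1 r2 _ IH1 _ IH2; rewrite mem_cat => /orP[/IH1|/IH2] //.
- move=> x g r _ IH; rewrite in_cons mem_rcons in_cons.
  move=> /or3P[/eqP ->|/eqP ->|/IH[y yg E]].
  + by exists x; [rewrite /= fset1U1|left].
  + by exists x; [rewrite /= fset1U1|right].
  + by exists y; rewrite //= in_fsetU yg orbT.
Qed.

End RefWords.

(** * Domain elements representing positions of the word *)

Section Positions.

Variables (Sigma : finType) (n : nat) (w : wstruct Sigma n).

Definition endpoint (i : 'I_n.+1) : bool := (i == ord_max) || isSome (w i).

(** For an endpoint this is the position it represents; at [$] it is [|w| + 1], as long as [$]
    carries no letter. *)
Definition start (i : nat) : nat := (size (wseg w 0 i)).+1.

Lemma letter_proper (i : 'I_n.+1) : w ord_max = None -> endpoint i -> i < n ->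
  exists a, letter w i = [:: a].
Proof.
move=> we; rewrite /endpoint letter_ord => /orP[/eqP -> /=|]; first by rewrite ltnn.
by case: (w i) => // a _ _; exists a.
Qed.

(** An endpoint below [j] contributes a letter; hence [start] is strictly increasing on
    endpoints. *)
Lemma size_wseg_proper x (i j : 'I_n.+1) : w ord_max = None -> endpoint i ->
  x <= i -> i < j -> size (wseg w x i) < size (wseg w x j).
Proof.
move=> we pi xi ij; rewrite (wseg_cat w xi (ltnW ij)) (wseg_recl _ ij) !size_cat.
have [|a ->] := letter_proper we pi; last by rewrite /=; lia.
exact: leq_trans ij (ltn_ord j).
Qed.

Lemma posE (i : 'I_n.+1) : pos w i = size (wseg w 0 i.+1).
Proof.
rewrite /wseg size_flatten sumnE subn0 /shape !big_map -[iota 0 _]/(index_iota 0 i.+1).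
rewrite big_mkord (big_ord_widen n.+1 (fun j => size (letter w j))) //.
rewrite /pos -sum1_card big_mkcond [RHS]big_mkcond /=.
apply: eq_bigr => j _; rewrite inE ltnS letter_ord.
by case: (j <= i); case: (w j).
Qed.

Lemma representsE (i : 'I_n.+1) m : w ord_max = None ->
  represents w i m = endpoint i && (m == start i).
Proof.
move=> we; rewrite /represents /endpoint /start word_of_end //.
case: eqP => [->|_] //=; rewrite posE; case wi: (w i) => [a|] //=.
rewrite (@wseg_cat _ _ _ _ i) // wsegS letter_ord wi size_cat /= addn1.
by rewrite eq_sym.
Qed.

Lemma proper_surj m : w ord_max = None -> 0 < m <= (size (word_of w)).+1 ->
  exists i : 'I_n.+1, endpoint i && (m == start i).
Proof.
case: m => // m we; rewrite /= ltnS leq_eqVlt word_of_end // => /orP[/eqP ->|lt].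
  by exists ord_max; rewrite /endpoint eqxx /start /=.
(* The cut leaves [m] letters before it; the first letter-carrying element after it represents
   position [m.+1]. *)
have [||c [/andP[_ cn] E1 E2]] := @wseg_cut _ _ w 0 n
  (take m (wseg w 0 n)) (drop m (wseg w 0 n)).
- by [].
- by rewrite cat_take_drop.
case D: (drop m _) E2 (size_drop m (wseg w 0 n)) => [|a s] E2.
  by move=> /= /esym/eqP; rewrite subn_eq0 leqNgt lt.
have [d [/andP[cd dn] F1 F2 _]] := wseg_cons E2 => _.
have dn' : d < n.+1 by rewrite ltnS ltnW.
exists (Ordinal dn'); apply/andP; split.
  move: F2; rewrite /endpoint (letter_ord _ (Ordinal dn')).
  by case: (w (Ordinal dn')) => [b|] //= _; rewrite orbT.
by rewrite /start /= (@wseg_cat _ _ w 0 c d) // E1 F1 cats0 size_take lt.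
Qed.

Lemma factor_wseg (i j : nat) : i <= j -> j <= n -> w ord_max = None ->
  factor (word_of w) (start i, start j) = wseg w i j.
Proof.
move=> ij jn we; rewrite /factor /start /= word_of_end // subSS.
rewrite (@wseg_cat _ _ w 0 i n) ?(leq_trans ij) // drop_size_cat //.
rewrite (@wseg_cat _ _ _ i j n) // (@wseg_cat _ _ _ 0 i j) // size_cat addKn.
by rewrite take_size_cat.
Qed.

Variables (pt : refsym Sigma -> 'I_n.+1) (L : seq (refsym Sigma)).

Hypothesis L_brackets : forall b, b \in L -> is_bracket b.

Lemma brackets_at_all s x : perm_eq s (brackets_at pt L x) ->
  all (@is_bracket Sigma) s.
Proof.
move=> /perm_mem E; apply/allP => b; rewrite E mem_filter => /andP[_].
exact: L_brackets.
Qed.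

Lemma clr_blocks x d r : blocks w pt L x d r -> clr r = wseg w x (x + d).
Proof.
elim: d x r => [|d IH] x r /=; first by move=> ->; rewrite addn0 wseg_nil.
case=> s [r' [/brackets_at_all As -> /IH E]].
rewrite !clr_cat clr_letters clr_brackets // E /= -addSnnS [RHS]wseg_recl //; lia.
Qed.

Lemma blocks_index x d r b : blocks w pt L x d r -> b \in L ->
  x <= pt b -> pt b < x + d ->
  size (clr (take (index b r) r)) = size (wseg w x (pt b)).
Proof.
elim: d x r => [|d IH] x r /=; first by move=> _ _; lia.
case=> s [r' [ps -> B]] bL xb bd; have As := brackets_at_all ps.
have := perm_mem ps b; rewrite mem_filter bL andbT.
case: eqP => [E|/eqP NE] bs.
  by rewrite take_index_catl // clr_take_brackets // E wseg_nil.
have {}xb : x < pt b by rewrite ltn_neqAle eq_sym NE.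
rewrite take_index_catr ?bs // take_index_catr; last first.
  exact/bracket_notin_letters/L_brackets.
rewrite !clr_cat clr_letters clr_brackets // (wseg_recl _ xb) !size_cat.
by rewrite (IH x.+1) //; lia.
Qed.

Hypothesis w_end : w ord_max = None.
Hypothesis L_uniq : uniq L.
Hypothesis L_endpoints : forall b, b \in L -> endpoint (pt b).

(** Induction on the elements from [x] on. Endpoints other than [$] carry letters, so the number of
    letters before a bracket determines its element, and the brackets of [r] split into those at [x]
    and those beyond. *)
Lemma blocks_complete x d r : x + d = n.+1 ->
  clr r = wseg w x n.+1 ->
  (forall b, is_bracket b -> count_mem b r <= 1) ->
  (forall b, is_bracket b -> (b \in r) = (b \in L) && (x <= pt b)) ->
  (forall b, is_bracket b -> b \in r ->
    size (clr (take (index b r) r)) = size (wseg w x (pt b))) ->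
  blocks w pt L x d r.
Proof.
elim: d x r => [|d IH] x r xd Er cr mr ir /=.
  rewrite addn0 in xd; move: Er; rewrite wseg_nil ?xd // => /clr_nil.
  case: r cr mr ir => // b r _ mr _ /= /andP[B _].
  by have := mr b B; rewrite mem_head xd leqNgt ltn_ord andbF.
have xn : x < n.+1 by lia.
case lx: (letter w x) (size_letter w x) => [|a []] //= _; last first.
  move: Er; rewrite (wseg_recl _ xn) lx /= => /clr_cons[s [r' [Dr As Er']]].
  have sB b : b \in s -> is_bracket b by apply: (allP As).
  have sr' b : is_bracket b -> b \in s -> b \notin r'.
    move=> B bs; apply/negP => br'; have := cr b B.
    move: bs br'; rewrite Dr count_cat -!has_pred1 !has_count /=; lia.
  have bl : Letter a \notin s by apply/negP => /sB.
  (* No letter precedes a bracket of [s], whereas an element beyond [x] has the letter [a] before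
     it. *)
  have s_pt b : b \in s -> pt b = x :> nat.
    move=> bs; have B := sB b bs.
    have br : b \in r by rewrite Dr mem_cat bs.
    have := mr b B; rewrite br => /esym/andP[bL xb].
    have := ir b B br; rewrite Dr take_index_catl // clr_take_brackets //=.
    case: (ltngtP x (pt b)) xb => // xb _.
    by rewrite (wseg_recl _ xb) lx.
  have r'_pt b : is_bracket b -> b \in r' -> x < pt b /\
      size (clr (take (index b r') r')) = size (wseg w x.+1 (pt b)).
    move=> B br'.
    have bs : b \notin s by apply: contraL br' => /sr'; apply.
    have br : b \in r by rewrite Dr mem_cat in_cons br' !orbT.
    have := mr b B; rewrite br => /esym/andP[bL xb].
    have := ir b B br; rewrite Dr take_index_catr // -cat1s.
    rewrite take_index_catr; last by case: (b) B.
    rewrite !clr_cat clr_brackets //=.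
    case: (ltngtP x (pt b)) xb => // [xb _|<- _]; last by rewrite wseg_nil.
    by rewrite (wseg_recl _ xb) lx /= => -[].
  exists s, r'; split; rewrite // ?lx //.
    apply: uniq_perm; last 1 first.
    - move=> b; rewrite mem_filter; apply/idP/andP => [bs|[/eqP pb bL]].
        have B := sB b bs; rewrite s_pt //; split=> //.
        by have := mr b B; rewrite Dr mem_cat bs => /esym/andP[].
      have B := L_brackets bL; have := mr b B; rewrite bL pb leqnn Dr mem_cat in_cons.
      case: (b \in s) => //= /orP[/eqP E|/(r'_pt b B)[]]; first by rewrite E in B.
      by rewrite pb ltnn.
    - apply: uniq_count_le1 => b /sB/cr; apply: leq_trans.
      by rewrite Dr count_cat leq_addr.
    - exact: filter_uniq.
  apply: IH => //; first by lia.
  - move=> b B; apply: leq_trans (cr b B); rewrite Dr count_cat /=; lia.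
  - move=> b B; apply/idP/andP => [br'|[bL xb]].
      have [? _] := r'_pt b B br'; split=> //.
      have := mr b B; rewrite Dr mem_cat in_cons br' !orbT.
      by move=> /esym/andP[].
    have := mr b B; rewrite bL (ltnW xb) Dr mem_cat in_cons => /or3P[bs|/eqP E|] //.
      by have := s_pt b bs; lia.
    by rewrite E in B.
  - by move=> b B /(r'_pt b B)[].
move: Er; rewrite (wseg_recl _ xn) lx /=.
have [xn'|nx] := ltnP x n.
  (* An element without a letter other than [$] is no endpoint, so no bracket sits there. *)
  move=> Er; exists [::], r.
  have pne b : b \in L -> pt b != x :> nat.
    move=> bL; apply/eqP => E; have [|a] := letter_proper w_end (L_endpoints bL).
      by rewrite E.
    by rewrite E lx.
  have ltE b : b \in L -> (x < pt b) = (x <= pt b).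
    by move=> /pne; rewrite (leq_eqVlt x) eq_sym => /negbTE ->.
  split; rewrite ?lx //.
    rewrite /brackets_at (eq_in_filter (a2 := pred0)) ?filter_pred0 //.
    by move=> b /pne/negbTE.
  apply: IH => //; first by lia.
    move=> b B; rewrite mr //; have [bL|//] := boolP (b \in L).
    by rewrite /= ltE.
  move=> b B br; rewrite ir //; move: (br); rewrite mr // => /andP[bL].
  by rewrite -ltE // => xb; rewrite (wseg_recl _ xb) lx.
(* Here [x] is [$]: all remaining brackets sit there, in the order in which [r] lists them. *)
have Ex : x = n by lia.
have -> : d = 0 by lia.
rewrite wseg_nil; last by rewrite Ex.
move=> /clr_nil Ar.
have rL b : b \in r -> b \in L /\ pt b = n :> nat.
  move=> br; have := mr b (allP Ar _ br); rewrite br => /esym/andP[-> xb].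
  by split=> //; have := ltn_ord (pt b); lia.
exists r, [::]; split; rewrite // ?lx ?cats0 //.
apply: uniq_perm.
- by apply: uniq_count_le1 => b br; apply: cr (allP Ar _ br).
- exact: filter_uniq.
- move=> b; rewrite mem_filter; apply/idP/andP => [/rL[-> ->]|[/eqP pb bL]].
    by rewrite Ex eqxx.
  by rewrite mr ?L_brackets // bL pb leqnn.
Qed.

End Positions.

(** * Definability of generalized core spanners *)

Definition assigned (Sigma : finType) (n : nat) (w : wstruct Sigma n)
    (V : {fset var}) (o c : var -> 'I_n.+1) : mapping :=
  [fmap x : V => (start w (o (val x)), start w (c (val x)))]%fmap.

(** Assignments are total functions, but only their values on [svars P] matter. The endpoint
    condition rules out elements without letters, for which [start] would also yield a number. *)
Definition sat (Sigma : finType) (P : spanner Sigma) (n : nat)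
    (w : wstruct Sigma n) (o c : var -> 'I_n.+1) : Prop :=
  (forall x, x \in svars P -> endpoint w (o x) && endpoint w (c x)) /\
  P (word_of w) (assigned w (svars P) o c).

(** * The spanner operators in terms of satisfying assignments *)

Section Assigned.

Variables (Sigma : finType) (n : nat) (w : wstruct Sigma n).

Implicit Types (V : {fset var}) (o c : var -> 'I_n.+1).

Lemma fnd_assigned V o c x :
  (assigned w V o c).[? x]%fmap =
  if x \in V then Some (start w (o x), start w (c x)) else None.
Proof.
by case: fndP => [xV|/negbTE xV]; rewrite ?ffunE /= ?xV.
Qed.

Lemma assigned_eq V o c (mu : mapping) : domf mu = V ->
  (forall x, x \in V -> mu.[? x]%fmap = Some (start w (o x), start w (c x))) ->
  mu = assigned w V o c.
Proof.
move=> D H; apply/fmapP => x; rewrite fnd_assigned; case: ifP => [/H //|xV].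
by rewrite not_fnd // -[_ \in _]/(x \in domf mu) D xV.
Qed.

Lemma restrict_assigned V1 V2 o c :
  ((assigned w V1 o c).[& V2])%fmap = assigned w (V2 `&` V1)%fset o c.
Proof.
apply/fmapP => x; rewrite fnd_restrict !fnd_assigned in_fsetI.
by case: (x \in V2).
Qed.

Lemma sat_eq (P : spanner Sigma) o c o' c' :
  (forall x, x \in svars P -> o x = o' x /\ c x = c' x) ->
  sat P w o c -> sat P w o' c'.
Proof.
move=> E [H1 H2]; split; first by move=> x xP; case: (E x xP) => <- <-; apply: H1.
congr (P _ _): H2; apply: assigned_eq => // x xP.
by rewrite fnd_assigned xP; case: (E x xP) => -> ->.
Qed.

Lemma sat_union (P1 P2 : spanner Sigma) (E : svars P1 = svars P2) o c :
  sat (union_spanner E) w o c <-> sat P1 w o c \/ sat P2 w o c.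
Proof.
rewrite /sat /= -E; split=> [[H [?|?]]|[[? ?]|[? ?]]]; [left|right|split|split] => //.
- by left.
- by right.
Qed.

Lemma sat_diff (P1 P2 : spanner Sigma) o c : svars P1 = svars P2 ->
  sat (diff_spanner P1 P2) w o c <-> sat P1 w o c /\ ~ sat P2 w o c.
Proof.
by rewrite /sat /= => <-; split=> [[H [? ?]]|[[H ?] N]]; do !split=> //; tauto.
Qed.

Lemma sat_join (P1 P2 : spanner Sigma) o c :
  sat (join_spanner P1 P2) w o c <-> sat P1 w o c /\ sat P2 w o c.
Proof.
rewrite /sat /= !restrict_assigned.
have -> : (svars P1 `&` (svars P1 `|` svars P2) = svars P1)%fset.
  by apply/fsetIidPl; apply: fsubsetUl.
have -> : (svars P2 `&` (svars P1 `|` svars P2) = svars P2)%fset.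
  by apply/fsetIidPl; apply: fsubsetUr.
split=> [[H [_ ? ?]]|[[H1 ?] [H2 ?]]].
  by do !split=> //; move=> x xP; apply: H; rewrite in_fsetU xP ?orbT.
by split=> // x; rewrite in_fsetU => /orP[/H1|/H2].
Qed.

Hypothesis w_end : w ord_max = None.

(** The inequality between the positions of a span transfers to the elements because [start] is
    strictly increasing on endpoints. *)
Lemma span_assigned (P : spanner Sigma) o c x : sat P w o c -> x \in svars P ->
  o x <= c x.
Proof.
move=> [H /mappings_span S] xP.
have := S x (start w (o x), start w (c x)); rewrite fnd_assigned xP => /(_ erefl).
case/and3P => _ /= le _; have /andP[po pc] := H x xP.
rewrite leqNgt; apply/negP => lt.
have := size_wseg_proper w_end pc (leq0n _) lt.
by move: le; rewrite /start ltnS leqNgt => /negP.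
Qed.

Lemma sat_eqsel (P : spanner Sigma) x y o c : x \in svars P -> y \in svars P ->
  sat (eqsel_spanner x y P) w o c <->
  sat P w o c /\ eq_factor w (o x) (c x) (o y) (c y).
Proof.
move=> xP yP; rewrite {1}/sat /= !fnd_assigned xP yP.
have fac z : sat P w o c -> z \in svars P ->
    factor (word_of w) (start w (o z), start w (c z)) = wseg w (o z) (c z).
  by move=> S zP; rewrite factor_wseg ?(span_assigned S) // -ltnS ltn_ord.
split=> [[H [A [s [t [[<-] [<-] E]]]]]|[S [_ _ E]]].
  have S : sat P w o c by [].
  by split=> //; split; rewrite -?fac // (span_assigned S).
case: (S) => H A; split=> //; split=> //; do 2 eexists; split; try reflexivity.
by rewrite !fac.
Qed.

(** For the positions of a span the search succeeds, so the default value is harmless. *)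
Definition position (m : nat) : 'I_n.+1 :=
  odflt ord_max [pick i | endpoint w i && (m == start w i)].

Lemma positionP m : 0 < m <= (size (word_of w)).+1 ->
  endpoint w (position m) && (m == start w (position m)).
Proof.
move=> Hm; rewrite /position; case: pickP => [i //|N].
by have [i] := proper_surj w_end Hm; rewrite N.
Qed.

Lemma sat_proj (P : spanner Sigma) Y o c : (Y `<=` svars P)%fset ->
  sat (proj_spanner Y P) w o c <->
  exists o' c', (forall x, x \in Y -> o' x = o x /\ c' x = c x) /\ sat P w o' c'.
Proof.
move=> YP; rewrite {1}/sat /=; have YI : (Y `&` svars P = Y)%fset by apply/fsetIidPl.
rewrite YI; split=> [[H [nu Pnu E]]|[o' [c' [E [H A]]]]].
  pose s x := odflt (1, 1) nu.[? x]%fmap.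
  exists (fun x => if x \in Y then o x else position (s x).1).
  exists (fun x => if x \in Y then c x else position (s x).2).
  split; first by move=> x ->.
  have D := mappings_dom Pnu.
  have nuE x : x \in svars P -> nu.[? x]%fmap = Some (s x).
    by rewrite -D /s -fndSome; case: fnd.
  have posE z : z \in svars P -> z \notin Y ->
      [/\ endpoint w (position (s z).1), (s z).1 = start w (position (s z).1),
        endpoint w (position (s z).2) & (s z).2 = start w (position (s z).2)].
    move=> zP _; have /and3P[s1 s2 s3] := mappings_span Pnu (nuE z zP).
    have /andP[? /eqP ?] : endpoint w (position (s z).1) &&
        ((s z).1 == start w (position (s z).1)).
      by apply: positionP; rewrite s1 (leq_trans s2).
    have /andP[? /eqP ?] : endpoint w (position (s z).2) &&
        ((s z).2 == start w (position (s z).2)).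
      by apply: positionP; rewrite s3 (leq_trans s1).
    by [].
  split=> [x xP|].
    by case: ifP => [/H //|/negbT xY]; have [-> _ -> _] := posE x xP xY.
  congr (P _ _): Pnu; apply: assigned_eq => // x xP.
  case: ifP => [xY|/negbT xY].
    by have := congr1 (fun f : mapping => f.[? x]%fmap) E; rewrite fnd_assigned fnd_restrict xY.
  have [_ <- _ <-] := posE x xP xY.
  by rewrite nuE //; case: (s x).
split; first by move=> x xY; have [<- <-] := E x xY; apply/H/(fsubsetP YP).
exists (assigned w (svars P) o' c') => //; rewrite restrict_assigned YI.
apply: esym; apply: assigned_eq => // x xY; rewrite fnd_assigned xY.
by have [-> ->] := E x xY.
Qed.

Definition bracket_point o c (b : refsym Sigma) : 'I_n.+1 :=
  match b with Open x => o x | Close x => c x | Letter _ => ord_max end.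

Definition brackets (V : {fset var}) : seq (refsym Sigma) :=
  map Open V ++ map Close V.

Lemma mem_brackets V b : (b \in brackets V) =
  match b with Open x => x \in V | Close x => x \in V | Letter _ => false end.
Proof.
rewrite mem_cat; case: b => [a|x|x].
- by apply/negP => /orP[] /mapP[].
- rewrite mem_map; last by move=> ? ? [].
  by rewrite orbC; case: mapP => // -[].
- rewrite (mem_map (f := Close)); last by move=> ? ? [].
  by case: mapP => // -[].
Qed.

Lemma uniq_brackets V : uniq (brackets V).
Proof.
rewrite cat_uniq !map_inj_uniq ?fset_uniq ?andbT /=; try by move=> ? ? [].
by apply/hasPn => _ /mapP[x _ ->]; apply/mapP => -[].
Qed.

(** A ref-word with the right spans has block form by [blocks_complete]; conversely, a block word
    has its brackets at the prescribed positions by [blocks_index]. Functionality provides validity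
    and uniqueness of the brackets. *)
Lemma sat_regex (g : regex Sigma) o c : functional g ->
  sat (regex_spanner g) w o c <->
  (forall x, x \in rvars g -> endpoint w (o x) && endpoint w (c x)) /\
  exists2 r, ref_lang g r &
    blocks w (bracket_point o c) (brackets (rvars g)) 0 n.+1 r.
Proof.
move=> fg; set V := rvars g; set pt := bracket_point o c; set L := brackets V.
have LB b : b \in L -> is_bracket b by rewrite mem_brackets; case: b.
have pL : (forall x, x \in V -> endpoint w (o x) && endpoint w (c x)) ->
    forall b, b \in L -> endpoint w (pt b).
  by move=> H b; rewrite mem_brackets; case: b => // x /H/andP[].
have memL r b : ref_lang g r -> is_bracket b -> (b \in r) = (b \in L).
  move=> gr B; rewrite mem_brackets; apply/idP/idP => [br|].
    by have [x xV [] ->] := bracket_in_rvars gr B br.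
  move: B; case: b => // x _ xV; have [cO cC _] := fg r gr x xV.
    by rewrite -has_pred1 has_count cO.
  by rewrite -has_pred1 has_count cC.
have UL : uniq L := uniq_brackets V.
split=> -[H].
  case=> r [gr vr cr E]; split=> //; exists r => //.
  have span_eq x : x \in V ->
      ref_span r x = (start w (o x), start w (c x)).
    move=> xV; have := congr1 (fun f : mapping => f.[? x]%fmap) E.
    rewrite fnd_assigned xV; case: fndP => [xV'|]; last by rewrite /= xV.
    by rewrite ffunE /= => -[E1 E2]; rewrite /ref_span /start E1 E2.
  apply: blocks_complete => //.
  - exact: pL.
  - by rewrite cr word_ofE.
  - move=> b B; have [bL|bL] := boolP (b \in L); last first.
      by rewrite (count_memPn _) // (memL r).
    by move: bL; rewrite mem_brackets; case: (b) => // x xV;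
      have [e1 e2 _] := fg r gr x xV; rewrite ?e1 ?e2.
  - by move=> b B; rewrite (memL r) // andbT.
  - move=> b B; rewrite (memL r) // mem_brackets.
    by case: (b) => // x xV; have := span_eq x xV; rewrite /ref_span /start => -[].
case=> r gr B; split=> //; exists r; split=> //.
- exact: fg.
- by rewrite (clr_blocks LB B) word_ofE.
apply: esym; apply: assigned_eq => // x xV.
have idx b : b \in L -> size (clr (take (index b r) r)) = size (wseg w 0 (pt b)).
  by move=> bL; apply: (blocks_index LB B).
case: fndP => [xV'|]; last by rewrite /= xV.
rewrite ffunE /= /ref_span /start -(idx (Open x)) ?mem_brackets //.
by rewrite -(idx (Close x)) ?mem_brackets.
Qed.

End Assigned.

(** * Definability by induction on the construction of the spanner *)

Section SpannerDefinability.

Variable Sigma : finType.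

Definition spanner_definable (N : automaton (refsym Sigma)) (P : spanner Sigma) :
    Prop :=
  forall tau (G : context Sigma tau) (o c : var -> point G), supports N G ->
    (forall x, is_term G (o x)) -> (forall x, is_term G (c x)) ->
    definable G (fun n e =>
      sat P (ctx_word e) (fun x => o x n e) (fun x => c x n e)).

Lemma definable_endpoints tau (G : context Sigma tau) (V : {fset var})
    (o c : var -> point G) :
  (forall x, is_term G (o x)) -> (forall x, is_term G (c x)) ->
  definable G (fun n e => forall x, x \in V ->
    endpoint (ctx_word e) (o x n e) && endpoint (ctx_word e) (c x n e)).
Proof.
have D p : is_term G p -> definable G (fun n e => endpoint (ctx_word e) (p n e)).
  move=> Hp; apply: (@definable_iff _ _ G (fun n e => p n e = ord_max \/
    ~ ctx_word e (p n e) = None)).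
    move=> n e; rewrite /endpoint; case: eqP => [->|ne]; first by split=> //; left.
    by case: (ctx_word e _) => [a|] /=; split=> //; [right|case].
  by defin.
move=> Ho Hc; apply: (@definable_iff _ _ G (fun n e => forall x, x \in enum_fset V ->
    endpoint (ctx_word e) (o x n e) /\ endpoint (ctx_word e) (c x n e))).
  by move=> n e; split=> H x /H => [[-> ->]|/andP].
by apply: definable_all_in => x _; defin; apply: D.
Qed.

Lemma spanner_definable_regex (g : regex Sigma) (N : automaton (refsym Sigma))
    (q0 : astate N) :
  functional g -> (forall r, ref_lang g r <-> accepts q0 r) ->
  spanner_definable N (regex_spanner g).
Proof.
move=> fg Hg tau G o c SG Ho Hc.
pose pt b : point G := fun n e =>
  bracket_point (Sigma := Sigma) (fun x => o x n e) (fun x => c x n e) b.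
have Hpt b : is_term G (pt b) by case: b => [a|x|x]; [exact: term_end|exact: Ho|exact: Hc].
pose L := brackets Sigma (rvars g).
(* The interval covering the whole domain ends at [n.+1], which is no element, so the block at [$]
   is a separate step. The left end is described as the least element. *)
apply: (@definable_iff _ _ G (fun n e =>
  (forall x, x \in rvars g ->
    endpoint (ctx_word e) (o x n e) && endpoint (ctx_word e) (c x n e)) /\
  exists z : 'I_n.+1, (forall d : 'I_n.+1, z <= d) /\ exists q1, exists q2,
    [/\ block_run (ctx_word e) (fun b => pt b n e) L q0 q1 z (ord_max : 'I_n.+1),
        block_step (ctx_word e) (fun b => pt b n e) L q1 q2 (ord_max : 'I_n.+1)
      & final q2])).
  move=> n e; rewrite (sat_regex (base_end (supports_base SG) e) _ _ fg).
  split=> -[H1 H2]; split=> //.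
    case: H2 => z [z0 [q1 [q2 [R1 /block_run1 R2 F]]]].
    have Ez : z = ord0 by apply/val_inj/eqP; rewrite -leqn0 (z0 ord0).
    rewrite Ez in R1.
    have /(block_run_cat _ _ _ _ _ (leq0n n) (leqnSn n)) : exists2 q,
        block_run (ctx_word e) (fun b => pt b n e) L q0 q 0 n &
        block_run (ctx_word e) (fun b => pt b n e) L q q2 n n.+1 by exists q1.
    case=> _ [r]; rewrite subn0 => B R; exists r => //.
    by apply/Hg/acceptsE; exists q2.
  case: H2 => r /Hg/acceptsE[q2 R F] B.
  have : block_run (ctx_word e) (fun b => pt b n e) L q0 q2 0 n.+1.
    by split=> //; exists r; rewrite ?subn0.
  move=> /(block_run_cat _ _ _ _ _ (leq0n n) (leqnSn n))[q1 R1 /block_run1 R2].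
  by exists ord0; split=> //; exists q1, q2.
apply: definable_and; first exact: definable_endpoints.
have SG' := supports_ext SG.
apply: definable_ex; weaken; apply: definable_and; first by defin.
defin.
- apply: (@definable_block_run _ N _ L (ext G) (fun b n e => pt b n e.1) _ _
    (fun n e => e.2) (fun n e => ord_max)) => //.
  exact: term_end.
- apply: (@definable_block_step _ N _ (ext G) (fun b n e => pt b n e.1) L _ _
    (fun n e => ord_max)) => //.
  exact: term_end.
Qed.

(** Quantification over assignments is not first-order as such, but only the finitely many variables
    in [zs] change, so two quantifiers per variable suffice. *)
Lemma definable_reassign (P : spanner Sigma) (N : automaton (refsym Sigma))
    (zs : seq var) : spanner_definable N P ->
  forall tau (G : context Sigma tau) (o c : var -> point G), supports N G ->
    (forall x, is_term G (o x)) -> (forall x, is_term G (c x)) ->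
    definable G (fun n e => exists o' c' : var -> 'I_n.+1,
      (forall x, x \notin zs -> o' x = o x n e /\ c' x = c x n e) /\
      sat P (ctx_word e) o' c').
Proof.
move=> DP; elim: zs => [|z zs IH] tau G o c SG Ho Hc.
  apply: definable_iff (DP tau G o c SG Ho Hc) => n e; split=> [S|[o' [c' [E S]]]].
    by exists (fun x => o x n e), (fun x => c x n e).
  by apply: sat_eq S => x _; apply: E.
(* The values at [z] are guessed first and built into the assignment from which the induction
   hypothesis starts. *)
apply: (@definable_iff _ _ G (fun n e => exists d d' : 'I_n.+1,
  exists o' c' : var -> 'I_n.+1, (forall x, x \notin zs ->
    o' x = (if x == z then d else o x n e) /\
    c' x = (if x == z then d' else c x n e)) /\ sat P (ctx_word e) o' c')).
  move=> n e; split=> [[d [d' [o' [c' [E S]]]]]|[o' [c' [E S]]]].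
    exists o', c'; split=> // x; rewrite in_cons negb_or => /andP[/negbTE xz /E].
    by rewrite xz.
  exists (o' z), (c' z), o', c'; split=> // x xzs.
  case: eqP => [->//|/eqP xz]; apply: E.
  by rewrite in_cons negb_or xz.
have SG2 := supports_ext (supports_ext SG).
do 2 (apply: definable_ex; weaken).
apply: (IH _ (ext (ext G)) (fun x n e => if x == z then e.1.2 else o x n e.1.1)
  (fun x n e => if x == z then e.2 else c x n e.1.1)) => // x; case: (x == z) => //.
Qed.

(** The automaton is assembled by disjoint sums along the construction. Stating definability for
    every [N] that simulates [N0] lets both operands share one automaton. *)
Lemma generalized_core_definable (P : spanner Sigma) : generalized_core P ->
  exists N0 : automaton (refsym Sigma), forall N, simulates N N0 ->
    spanner_definable N P.
Proof.
elim=> {P}.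
- move=> g fg; have [N0 [q0 H]] := recognizable_regex g; exists N0 => N S.
  have [q Hq] := S q0; apply: (spanner_definable_regex (q0 := q) fg) => r.
  by rewrite H.
- move=> P1 P2 E _ [N1 D1] _ [N2 D2]; have [N0 H] := simulates_sum N1 N2.
  exists N0 => N /H[/D1{}D1 /D2{}D2] tau G o c SG Ho Hc.
  apply: definable_iff (definable_or (D1 _ _ _ _ SG Ho Hc) (D2 _ _ _ _ SG Ho Hc)) => n e.
  by rewrite sat_union.
- move=> Y P YP _ [N0 D]; exists N0 => N /D{}D tau G o c SG Ho Hc.
  apply: definable_iff (definable_reassign (enum_fset (svars P `\` Y)%fset) D SG Ho Hc) => n e.
  rewrite (sat_proj (base_end (supports_base SG) e)) //.
  split=> -[o' [c' [E S]]].
    exists o', c'; split=> // x xY; apply: E.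
    by rewrite -[_ \in _]/(x \in (svars P `\` Y)%fset) in_fsetD xY.
  (* The definable form permits changes only on [svars P] minus [Y], so values outside [svars P] are
     reset to the original ones; [sat] does not see them. *)
  exists (fun x => if x \in svars P then o' x else o x n e).
  exists (fun x => if x \in svars P then c' x else c x n e); split.
    move=> x; rewrite -[_ \in _]/(x \in (svars P `\` Y)%fset) in_fsetD negb_and negbK.
    by case: ifP => // xP /orP[/E|].
  by apply: sat_eq S => x ->.
- move=> P1 P2 _ [N1 D1] _ [N2 D2]; have [N0 H] := simulates_sum N1 N2.
  exists N0 => N /H[/D1{}D1 /D2{}D2] tau G o c SG Ho Hc.
  apply: definable_iff (definable_and (D1 _ _ _ _ SG Ho Hc) (D2 _ _ _ _ SG Ho Hc)) => n e.
  by rewrite sat_join.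
- move=> x y P xP yP _ [N0 D]; exists N0 => N /D{}D tau G o c SG Ho Hc.
  apply: definable_iff (definable_and (D _ _ _ _ SG Ho Hc)
    (base_eq_factor (supports_base SG) (Ho x) (Hc x) (Ho y) (Hc y))) => n e.
  by rewrite (sat_eqsel (base_end (supports_base SG) e)).
- move=> P1 P2 E _ [N1 D1] _ [N2 D2]; have [N0 H] := simulates_sum N1 N2.
  exists N0 => N /H[/D1{}D1 /D2{}D2] tau G o c SG Ho Hc.
  apply: definable_iff (definable_and (D1 _ _ _ _ SG Ho Hc)
    (definable_not (D2 _ _ _ _ SG Ho Hc))) => n e.
  by rewrite sat_diff.
Qed.

End SpannerDefinability.

(** * The dynamic program *)

Section Program.

Variables (Sigma : finType) (N : automaton (refsym Sigma)) (P : spanner Sigma)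
  (k : nat) (xs : k.-tuple var).

Hypothesis xs_uniq : uniq xs.
Hypothesis xs_svars : svars P =i xs.
Hypothesis P_definable : spanner_definable N P.

Let Q : word_relation Sigma (2 * k) := spanner_relation P xs.

Lemma spanner_relationE n (w : wstruct Sigma n) (t : (2 * k).-tuple 'I_n.+1) :
  w ord_max = None ->
  Q w t <-> sat P w (fun x => nth ord_max t (2 * index x xs))
                    (fun x => nth ord_max t (2 * index x xs).+1).
Proof.
move=> we; split=> [[mu Pmu H]|[H A]].
  have val x : x \in svars P ->
    endpoint w (nth ord_max t (2 * index x xs)) &&
    endpoint w (nth ord_max t (2 * index x xs).+1) /\
    mu.[? x]%fmap = Some (start w (nth ord_max t (2 * index x xs)),
                          start w (nth ord_max t (2 * index x xs).+1)).
    rewrite xs_svars => xxs; have ik : index x xs < k by rewrite -index_mem size_tuple in xxs.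
    have [[s1 s2] []] := H (Ordinal ik).
    rewrite (tnth_nth x) /= nth_index // !representsE // => Es.
    by move=> /andP[-> /eqP <-] /andP[-> /eqP <-].
  split=> [x /val[] //|].
  congr (P _ _): (Pmu); apply: assigned_eq; first exact: mappings_dom Pmu.
  by move=> x /val[].
exists (assigned w (svars P) (fun x => nth ord_max t (2 * index x xs))
          (fun x => nth ord_max t (2 * index x xs).+1)) => // i.
have ix : index (tnth xs i) xs = i.
  by rewrite (tnth_nth 0) index_uniq // size_tuple.
have iP : tnth xs i \in svars P by rewrite xs_svars mem_tnth.
have := H _ iP; rewrite fnd_assigned iP ix => /andP[p1 p2].
by eexists; split; [reflexivity| |]; rewrite representsE // ?p1 ?p2 /=.
Qed.

(** Stated for any context that supports the base relations, so that one proof serves the empty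
    structure and the updated one. *)
Lemma definable_prog_rel tau (G : context Sigma tau) (R : sym (prog_sig N (2 * k)))
    (x : forall n, G n -> (arity R).-tuple 'I_n.+1) :
  supports N G -> (forall i, is_term G (fun n e => tnth (x n e) i)) ->
  definable G (fun n e => prog_rel Q (ctx_word e) (x n e)).
Proof.
case: R x => [[[s s']|]|] x SG Hx /=.
- by apply: (base_seg_run (supports_base SG)).
- by apply: (base_eq_factor (supports_base SG)).
(* Beyond the tuple, [nth] returns [ord_max], which is the term [$]; this occurs for variables not
   in [xs]. *)
have Hn j : is_term G (fun n e => nth ord_max (x n e) j).
  have [jk|kj] := ltnP j (2 * k).
    have [t Ht] := Hx (Ordinal jk); exists t => n e.
    by rewrite -Ht (tnth_nth ord_max).
  by exists TEnd => n e; rewrite nth_default // size_tuple.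
have := P_definable SG (fun y => Hn (2 * index y xs)) (fun y => Hn (2 * index y xs).+1).
apply: definable_iff => n e.
by rewrite spanner_relationE // (base_end (supports_base SG)).
Qed.

Lemma init_formula_exists (R : sym (prog_sig N (2 * k))) :
  exists phi : formula Sigma no_aux (arity R), forall n x,
    eval (empty_wstruct Sigma n) (@no_aux_structure n) phi x <->
    prog_rel Q (empty_wstruct Sigma n) x.
Proof.
pose G := @Context Sigma no_aux (fun n => (arity R).-tuple 'I_n.+1) (arity R)
  (fun n _ => empty_wstruct Sigma n) (fun n _ => @no_aux_structure n) (fun n x => x).
have SG : supports N G by apply: supports_empty.
have [phi H] := @definable_prog_rel _ G R (fun n x => x) SG (@term_var _ _ G).
by exists phi => n x; rewrite -(H n x).
Qed.

(** Bundles the old word, the updated element, the stored relations and the arguments with the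
    invariant; definability over this model is then correctness of an update formula under the
    invariant. *)
Definition update_model (o : update_op Sigma) (m n : nat) : Type :=
  {c : wstruct Sigma n * 'I_n.+1 * aux_structure (prog_sig N (2 * k)) n *
       m.-tuple 'I_n.+1 |
    [/\ c.1.1.2 != ord_max, c.1.1.1 ord_max = None &
      forall R (x : (arity R).-tuple 'I_n.+1), c.1.2 R x <-> prog_rel Q c.1.1.1 x]}.

Lemma update_formula_exists (o : update_op Sigma) (R : sym (prog_sig N (2 * k))) :
  exists phi : formula Sigma (prog_sig N (2 * k)) (arity R).+1,
    forall n (w : wstruct Sigma n) (u : 'I_n.+1) (A : aux_structure _ n) x,
    u != ord_max -> w ord_max = None ->
    (forall R (x : (arity R).-tuple 'I_n.+1), A R x <-> prog_rel Q w x) ->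
    eval (update w o u) A phi (cons_tuple u x) <-> prog_rel Q (update w o u) x.
Proof.
pose G := @Context Sigma (prog_sig N (2 * k)) (update_model o (arity R)) (arity R).+1
  (fun n c => update (sval c).1.1.1 o (sval c).1.1.2) (fun n c => (sval c).1.2)
  (fun n c => cons_tuple (sval c).1.1.2 (sval c).2).
have U : @update_context _ N _ Q o G (fun n c => (sval c).1.1.1)
    (fun n c => (sval c).1.1.2).
  split.
  - by exists (TVar ord0) => n c; rewrite /= (tnth_nth ord_max).
  - by [].
  - by move=> n [c []].
  - by move=> n [c []].
  - by move=> n [c []].
have SG := supports_update U.
have Hx i : is_term G (fun n c => tnth (sval c).2 i).
  exists (TVar (lift ord0 i)) => n c /=.
  by rewrite (tnth_nth ord_max) [RHS](tnth_nth ord_max).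
have [phi H] := @definable_prog_rel _ G R (fun n c => (sval c).2) SG Hx.
exists phi => n w u A x un we HA.
by have := H n (exist _ (w, u, A, x) (And3 un we HA)).
Qed.

Lemma spanner_relation_in_DynFO : in_DynFO Q.
Proof.
have [fi Hi] := fin_all_exists init_formula_exists.
have [fr Hr] := fin_all_exists (update_formula_exists (@Reset Sigma)).
have [fa Ha] := fin_all_exists (fun a => fin_all_exists (update_formula_exists (Ins a))).
pose fu o : forall R, formula Sigma (prog_sig N (2 * k)) (arity R).+1 :=
  match o with Ins a => fa a | Reset => fr end.
exists (DynProgram fi fu), None, erefl => n s.
(* The invariant covers all stored relations at once and the absence of a letter at [$], since the
   update formulas are correct only under both. *)
suff inv : reachable s -> st_word s ord_max = None /\
    forall R (x : (arity R).-tuple 'I_n.+1),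
      st_aux s x <-> prog_rel Q (st_word s) x.
  by move=> /inv[_ H] x; rewrite tcast_id; apply: H.
elim=> {s} [|s o u _ [we HA] /andP[un _]].
  by split; [rewrite /= ffunE|move=> R x; exact: (Hi R n x)].
split; first by rewrite /= ffunE eq_sym (negbTE un).
move=> R x /=; case: o => [a|].
  exact: Ha.
exact: Hr.
Qed.

End Program.

Theorem mainTheorem19 (Sigma : finType) (P : spanner Sigma)
    (hP : generalized_core P)
    (k : nat) (xs : k.-tuple var) (xs_uniq : uniq xs)
    (xs_svars : svars P =i xs) :
  in_DynFO (spanner_relation P xs).
Proof.
have [N D] := generalized_core_definable hP.
apply: (spanner_relation_in_DynFO xs_uniq xs_svars); apply: D.
by move=> q; exists q.
Qed.
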